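(* Let $p$ be a parabolic point of a smooth ruled surface $R$ in $\mathbb R^4\subset\mathbb RP^4$. Then the 4-jet at $p$ of the Monge form of $R$ is projectively equivalent to $$(x,\;y,\;x^2+\Gamma_{40}x^4+\Gamma_{31}x^3y,\;xy+\Theta_{40}x^4)$$ for some real constants $\Gamma_{40},\Gamma_{31},\Theta_{40}$.
   Context: Ruled surface: $I\subset\mathbb R$ is an open interval, $\mathbf x:I\to\mathbb R^4$ and $\mathbf e:I\to\mathbb R^4\setminus\{0\}$ are smooth, $F(u,t)=\mathbf x(u)+t\,\mathbf e(u)$ and $R=F(I\times\mathbb R)$. Only smooth points and non-developable surfaces are considered: $\mathbf x'(u),\mathbf e(u),\mathbf e'(u)$ are linearly independent for every $u$. Monge form at $p$: in affine coordinates $(x,y,z,w)$ centred at $p$ with $T_pR$ the $xy$-plane and the ruling through $p$ equal to the $y$-axis, $R$ is the graph $z=f^1(x,y)$, $w=f^2(x,y)$ with $j^1f^i(0,0)=0$. The point $p$ is parabolic if the quadratic parts of $f^1$ and $f^2$ are linearly independent (for ruled surfaces $\delta=(an-cl)^2-4(am-bl)(bn-cm)$ vanishes identically, where $lx^2+2mxy+ny^2$ and $ax^2+2bxy+cy^2$ are the quadratic parts of $f^1$ and $f^2$). Projective equivalence of $k$-jets: two Monge forms $(f^1,f^2)$ and $(g^1,g^2)$ have projectively equivalent $k$-jets at the origin if there is a projective transformation preserving the origin and the $xy$-plane, i.e. a diffeomorphism-germ $\Psi=(q_1/p,q_2/p,q_3/p,q_4/p)$ of $(\mathbb R^4,0)$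 with $q_1=q_{11}x+q_{12}y+q_{13}z+q_{14}w$, $q_2=q_{21}x+q_{22}y+q_{23}z+q_{24}w$, $q_3=q_{33}z+q_{34}w$, $q_4=q_{43}z+q_{44}w$, $p=1+p_1x+p_2y+p_3z+p_4w$ (real coefficients), such that $$\big(q_3/p-f^1(q_1/p,q_2/p),\ q_4/p-f^2(q_1/p,q_2/p)\big)\Big|_{z=g^1(x,y),\,w=g^2(x,y)}=o(k),$$ where $o(k)$ denotes function-germs of order greater than $k$. *)

(* Defs.v *)
(* The real numbers are Stdlib's R: linear algebra in R^4 uses MathComp matrices
   over R (instance from Rstruct), calculus uses Coquelicot. *)
From Stdlib Require Import Reals.
From Coquelicot Require Import Coquelicot.
From mathcomp Require Import all_boot all_algebra.
From mathcomp Require Import Rstruct.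

Set Implicit Arguments.
Unset Strict Implicit.
Unset Printing Implicit Defensive.

Local Open Scope ring_scope.
Local Open Scope R_scope.

Notation vec4 := ('rV[R]_4).

Definition ix : 'I_4 := @Ordinal 4 0 isT.
Definition iy : 'I_4 := @Ordinal 4 1 isT.
Definition iz : 'I_4 := @Ordinal 4 2 isT.
Definition iw : 'I_4 := @Ordinal 4 3 isT.

Definition crd (v : vec4) (i : 'I_4) : R := v ord0 i.

(* C^oo curves on the open interval ]a, b[; values outside it are irrelevant. *)
Definition in_interval (a b : Rbar) (u : R) : Prop :=
  Rbar_lt a u /\ Rbar_lt u b.

Definition smooth_curve (a b : Rbar) (c : R -> vec4) : Prop :=
  forall (i : 'I_4) (n : nat) (u : R),
    in_interval a b u -> ex_derive_n (fun v => crd (c v) i) n u.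

Definition dcurve (c : R -> vec4) (u : R) : vec4 :=
  (\row_i Derive (fun v => crd (c v) i) u)%R.

Record ruled_surface (a b : Rbar) (x e : R -> vec4) : Prop := RuledSurface {
  ruled_smooth_base : smooth_curve a b x;
  ruled_smooth_dir : smooth_curve a b e;
  ruled_dir_neq0 : forall u, in_interval a b u -> e u <> 0%R;
  ruled_nondevelopable : forall u, in_interval a b u ->
    free [:: dcurve x u; e u; dcurve e u]
}.

Definition ruled_map (x e : R -> vec4) (u t : R) : vec4 :=
  (x u + t *: e u)%R.

(* C^oo germs at the origin of R^2, all orders on a common neighbourhood. *)
Definition smooth_germ (h : R -> R -> R) : Prop :=
  locally_2d (fun x y => forall n : nat, ex_diff_n h n x y) 0 0.

(* h = o(k): the smooth germ h has order greater than k, that is, all its Taylor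
   coefficients at the origin of degree at most k are zero. *)
Definition order_gt (k : nat) (h : R -> R -> R) : Prop :=
  smooth_germ h /\
  forall i j : nat, (i + j <= k)%N -> partial_derive i j h 0 0 = 0.

Definition quadratic_part (f : R -> R -> R) (x y : R) : R :=
  partial_derive 2 0 f 0 0 / 2 * x ^ 2
  + partial_derive 1 1 f 0 0 * (x * y)
  + partial_derive 0 2 f 0 0 / 2 * y ^ 2.

(* Affine coordinates centred at p = ruled_map x e u0 t0, with linear part A
   acting on row vectors. *)
Definition affine_coords (A : 'M[R]_4) (p q : vec4) : vec4 :=
  ((q - p) *m A)%R.

(* (f1, f2) is a Monge form at p = ruled_map x e u0 t0 of the germ of the surface
   parametrised near (u0, t0), in the affine coordinates given by A. The tangent
   plane is spanned by the two partial derivatives of ruled_map, here x' + t0 e'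
   and e; the second lies on the y-axis by monge_ruling. *)
Record monge_form (x e : R -> vec4) (u0 t0 : R) (A : 'M[R]_4)
    (f1 f2 : R -> R -> R) : Prop := MongeForm {
  monge_affine : A \in unitmx;
  monge_ruling : forall i, i != iy -> crd (e u0 *m A)%R i = 0;
  monge_tangent : forall i, i \in [:: iz; iw] ->
    crd (dcurve (fun u => ruled_map x e u t0) u0 *m A)%R i = 0;
  monge_jet1 : order_gt 1 f1 /\ order_gt 1 f2;
  monge_graph : locally_2d (fun u t =>
    let q := affine_coords A (ruled_map x e u0 t0) (ruled_map x e u t) in
    crd q iz = f1 (crd q ix) (crd q iy) /\
    crd q iw = f2 (crd q ix) (crd q iy)) u0 t0
}.

Definition independent_quadratic_parts (f1 f2 : R -> R -> R) : Prop :=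
  forall c1 c2 : R,
    (forall x y, c1 * quadratic_part f1 x y + c2 * quadratic_part f2 x y = 0) ->
    c1 = 0 /\ c2 = 0.

(* The condition does not depend on the Monge form chosen at the point. *)
Definition parabolic_point (x e : R -> vec4) (u0 t0 : R) : Prop :=
  exists (A : 'M[R]_4) (f1 f2 : R -> R -> R),
    monge_form x e u0 t0 A f1 f2 /\ independent_quadratic_parts f1 f2.

Definition lin4 (c : vec4) (x y z w : R) : R :=
  crd c ix * x + crd c iy * y + crd c iz * z + crd c iw * w.

(* Row i of Q lists the coefficients of the numerator q_i, and pr those of the
   nonconstant part of the denominator p. As p = 1 at the origin, Q is the
   Jacobian matrix of (q_1/p, ..., q_4/p) there, so that Q \in unitmx says that
   this map is a diffeomorphism-germ. *)
Definition proj_equiv_jets (k : nat) (f1 f2 g1 g2 : R -> R -> R) : Prop :=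
  exists (Q : 'M[R]_4) (pr : vec4),
    [/\ Q \in unitmx,
        forall i j, i \in [:: iz; iw] -> j \in [:: ix; iy] -> Q i j = 0 &
        let p x y := 1 + lin4 pr x y (g1 x y) (g2 x y) in
        let q i x y := lin4 (row i Q) x y (g1 x y) (g2 x y) in
        order_gt k (fun x y => q iz x y / p x y
                      - f1 (q ix x y / p x y) (q iy x y / p x y)) /\
        order_gt k (fun x y => q iw x y / p x y
                      - f2 (q ix x y / p x y) (q iy x y / p x y))].

(* Main.v *)
(* Near p the surface is swept by the lines t |-> F(u, t), so in Monge form the
   functions X, Y, Z, W of (u, t) are affine in t. Comparing in Z = f^i(X, Y) the
   coefficients of sigma^a tau^b with b >= 2 (sigma = u - u0, tau = t - t0) gives, for both
   f^i with the same constants k and lam, and with f_{ab} the coefficient of x^a y^b,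
     f_{0b} = 0,  f_{12} = k f_{11},  f_{13} = k^2 f_{11},
     f_{22} = 2 k f_{21} - k^2 f_{20} + lam f_{11}.
   At a parabolic point the vectors (f^i_{20})_i and (f^i_{11})_i form a basis of R^2, so up
   to a linear change of (z, w) the quadratic parts are x^2 and xy. The remaining
   parameters q_14, q_23, q_24, p_1, p_2 of the projective group then remove all cubic terms
   and p_3, p_4 the terms x^3 y, x^2 y^2 of f^2; the relations above make the other
   unwanted quartic terms vanish automatically.
   A smooth germ in two variables has order > 4 as soon as its restrictions to all lines
   s |-> (s, b s) do, which reduces everything to truncated polynomials in s. *)
Require Import Defs.
From Stdlib Require Import Reals Lra.
From Coquelicot Require Import Coquelicot.
From mathcomp Require Import all_boot all_algebra.
From mathcomp Require Import Rstruct.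

Local Open Scope R_scope.

(** * Smooth functions of two variables *)

(** [ex_diff_n] constrains iterated partial derivatives at a single point. Asking for it on a
    neighbourhood lets a partial derivative be replaced by any closed formula valid near the point,
    which the inductions on [n] below rely on. *)
Definition differentiable_near (n : nat) (f : R -> R -> R) (x y : R) : Prop :=
  locally_2d (ex_diff_n f n) x y.

Lemma locally_2d_idem (P : R -> R -> Prop) (x y : R) :
  locally_2d P x y -> locally_2d (locally_2d P) x y.
Proof. by apply: locally_2d_impl_strong; apply: locally_2d_forall. Qed.

Lemma locally_2d_preimage (P : R -> R -> Prop) (f g : R -> R -> R) (x y : R) :
  continuity_2d_pt f x y -> continuity_2d_pt g x y ->
  locally_2d P (f x y) (g x y) -> locally_2d (fun u v => P (f u v) (g u v)) x y.
Proof.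
move=> cf cg [d Hd].
apply: locally_2d_impl (cf d); apply: locally_2d_impl (cg d).
by apply: locally_2d_forall => u v Hg Hf; apply: Hd.
Qed.

Lemma continuity_2d_pt_comp (h f g : R -> R -> R) (x y : R) :
  continuity_2d_pt h (f x y) (g x y) ->
  continuity_2d_pt f x y -> continuity_2d_pt g x y ->
  continuity_2d_pt (fun u v => h (f u v) (g u v)) x y.
Proof.
move=> ch cf cg eps.
exact: (locally_2d_preimage (fun u v => Rabs (h u v - h (f x y) (g x y)) < eps)).
Qed.

(** Introduction rule for one more order: [fx] and [fy] agree with the partial derivatives near
    every nearby point, so they can be exchanged for [Derive] at the remaining [n] orders. *)
Lemma differentiable_near_S (n : nat) (f fx fy : R -> R -> R) (x y : R) :
  locally_2d (fun u v => is_derive (fun z => f z v) u (fx u v)) x y ->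
  locally_2d (fun u v => is_derive (fun z => f u z) v (fy u v)) x y ->
  locally_2d (continuity_2d_pt f) x y ->
  differentiable_near n fx x y -> differentiable_near n fy x y ->
  differentiable_near n.+1 f x y.
Proof.
move=> /locally_2d_idem Hx /locally_2d_idem Hy Hc Hfx Hfy.
apply: locally_2d_impl Hx; apply: locally_2d_impl Hy; apply: locally_2d_impl Hc.
apply: locally_2d_impl Hfx; apply: locally_2d_impl Hfy.
apply: locally_2d_forall => u v nfy nfx cf Hy Hx.
have dx := locally_2d_singleton _ _ _ Hx.
have dy := locally_2d_singleton _ _ _ Hy.
split=> //; split; first by eexists; exact: dx.
split; first by eexists; exact: dy.
split; [apply: ex_diff_n_ext_loc nfx | apply: ex_diff_n_ext_loc nfy].
- apply: locally_2d_impl Hx; apply: locally_2d_forall => u' v' H.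
  by symmetry; apply: is_derive_unique.
- apply: locally_2d_impl Hy; apply: locally_2d_forall => u' v' H.
  by symmetry; apply: is_derive_unique.
Qed.

Lemma differentiable_near_continuity (n : nat) (f : R -> R -> R) (x y : R) :
  differentiable_near n f x y -> locally_2d (continuity_2d_pt f) x y.
Proof.
apply: locally_2d_impl; apply: locally_2d_forall => u v.
by case: n => [|n] [].
Qed.

Lemma differentiable_near_le (m n : nat) (f : R -> R -> R) (x y : R) :
  (m <= n)%N -> differentiable_near n f x y -> differentiable_near m f x y.
Proof.
move=> /leP le_mn; apply: locally_2d_impl; apply: locally_2d_forall => u v.
exact: ex_diff_n_m.
Qed.

Lemma differentiable_near_x (n : nat) (f : R -> R -> R) (x y : R) :
  differentiable_near n.+1 f x y ->
  locally_2d (fun u v => is_derive (fun z => f z v) u (Derive (fun z => f z v) u)) x y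
  /\ differentiable_near n (fun u v => Derive (fun z => f z v) u) x y.
Proof.
move=> H; split; apply: locally_2d_impl H; apply: locally_2d_forall => u v [_ [Hx [_ [H _]]]] //.
exact: Derive_correct.
Qed.

Lemma differentiable_near_y (n : nat) (f : R -> R -> R) (x y : R) :
  differentiable_near n.+1 f x y ->
  locally_2d (fun u v => is_derive (fun z => f u z) v (Derive (fun z => f u z) v)) x y
  /\ differentiable_near n (fun u v => Derive (fun z => f u z) v) x y.
Proof.
move=> H; split; apply: locally_2d_impl H; apply: locally_2d_forall => u v [_ [_ [Hy [_ H]]]] //.
exact: Derive_correct.
Qed.

Lemma differentiable_near_const (n : nat) (c x y : R) :
  differentiable_near n (fun _ _ => c) x y.
Proof.
have cc u v : continuity_2d_pt (fun _ _ => c) u v by exact: continuity_2d_pt_const.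
elim: n c cc => [|n IHn] c cc; first by apply: locally_2d_forall.
apply: (differentiable_near_S _ _ (fun _ _ => 0) (fun _ _ => 0)).
- by apply: locally_2d_forall => u v; apply: is_derive_const.
- by apply: locally_2d_forall => u v; apply: is_derive_const.
- by apply: locally_2d_forall.
- by apply: IHn => u v; apply: continuity_2d_pt_const.
- by apply: IHn => u v; apply: continuity_2d_pt_const.
Qed.

Lemma differentiable_near_fst (n : nat) (x y : R) :
  differentiable_near n (fun u _ => u) x y.
Proof.
have cc : locally_2d (continuity_2d_pt (fun u _ => u)) x y.
  by apply: locally_2d_forall => u v; exact: continuity_2d_pt_id1.
case: n => [|n]; first by apply: locally_2d_impl cc; apply: locally_2d_forall.
apply: (differentiable_near_S _ _ (fun _ _ => 1) (fun _ _ => 0)) => //.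
- by apply: locally_2d_forall => u v; apply: is_derive_id.
- by apply: locally_2d_forall => u v; apply: is_derive_const.
- exact: differentiable_near_const.
- exact: differentiable_near_const.
Qed.

Lemma differentiable_near_snd (n : nat) (x y : R) :
  differentiable_near n (fun _ v => v) x y.
Proof.
have cc : locally_2d (continuity_2d_pt (fun _ v => v)) x y.
  by apply: locally_2d_forall => u v; exact: continuity_2d_pt_id2.
case: n => [|n]; first by apply: locally_2d_impl cc; apply: locally_2d_forall.
apply: (differentiable_near_S _ _ (fun _ _ => 0) (fun _ _ => 1)) => //.
- by apply: locally_2d_forall => u v; apply: is_derive_const.
- by apply: locally_2d_forall => u v; apply: is_derive_id.
- exact: differentiable_near_const.
- exact: differentiable_near_const.
Qed.

Lemma differentiable_near_plus (n : nat) (f g : R -> R -> R) (x y : R) :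
  differentiable_near n f x y -> differentiable_near n g x y ->
  differentiable_near n (fun u v => f u v + g u v) x y.
Proof.
move=> Hf Hg.
have cc : locally_2d (continuity_2d_pt (fun u v => f u v + g u v)) x y.
  apply: locally_2d_impl (differentiable_near_continuity _ _ _ _ Hf).
  apply: locally_2d_impl (differentiable_near_continuity _ _ _ _ Hg).
  by apply: locally_2d_forall => u v cg cf; exact: continuity_2d_pt_plus.
elim: n f g Hf Hg cc => [|n IHn] f g Hf Hg cc.
  by apply: locally_2d_impl cc; apply: locally_2d_forall.
have [Hfx Hfx'] := differentiable_near_x _ _ _ _ Hf.
have [Hfy Hfy'] := differentiable_near_y _ _ _ _ Hf.
have [Hgx Hgx'] := differentiable_near_x _ _ _ _ Hg.
have [Hgy Hgy'] := differentiable_near_y _ _ _ _ Hg.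
have cP h k : differentiable_near n h x y -> differentiable_near n k x y ->
    differentiable_near n (fun u v => h u v + k u v) x y.
  move=> Hh Hk; apply: IHn => //.
  apply: locally_2d_impl (differentiable_near_continuity _ _ _ _ Hh).
  apply: locally_2d_impl (differentiable_near_continuity _ _ _ _ Hk).
  by apply: locally_2d_forall => u v ck ch; exact: continuity_2d_pt_plus.
apply: (differentiable_near_S _ _ _ _ _ _ _ _ cc (cP _ _ Hfx' Hgx') (cP _ _ Hfy' Hgy')).
- apply: locally_2d_impl Hfx; apply: locally_2d_impl Hgx; apply: locally_2d_forall => u v Hg1 Hf1.
  exact: (is_derive_plus (fun z => f z v) (fun z => g z v)).
- apply: locally_2d_impl Hfy; apply: locally_2d_impl Hgy; apply: locally_2d_forall => u v Hg1 Hf1.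
  exact: (is_derive_plus (fun z => f u z) (fun z => g u z)).
Qed.

Lemma differentiable_near_mult (n : nat) (f g : R -> R -> R) (x y : R) :
  differentiable_near n f x y -> differentiable_near n g x y ->
  differentiable_near n (fun u v => f u v * g u v) x y.
Proof.
elim: n f g => [|n IHn] f g Hf Hg.
all: have cc : locally_2d (continuity_2d_pt (fun u v => f u v * g u v)) x y.
1,3: apply: locally_2d_impl (differentiable_near_continuity _ _ _ _ Hf);
  apply: locally_2d_impl (differentiable_near_continuity _ _ _ _ Hg);
  by apply: locally_2d_forall => u v cg cf; exact: continuity_2d_pt_mult.
  by apply: locally_2d_impl cc; apply: locally_2d_forall.
have [Hfx Hfx'] := differentiable_near_x _ _ _ _ Hf.
have [Hfy Hfy'] := differentiable_near_y _ _ _ _ Hf.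
have [Hgx Hgx'] := differentiable_near_x _ _ _ _ Hg.
have [Hgy Hgy'] := differentiable_near_y _ _ _ _ Hg.
have Hf' := differentiable_near_le _ _ _ _ _ (leqnSn n) Hf.
have Hg' := differentiable_near_le _ _ _ _ _ (leqnSn n) Hg.
apply: (differentiable_near_S _ _ _ _ _ _ _ _ cc
  (differentiable_near_plus _ _ _ _ _ (IHn _ _ Hfx' Hg') (IHn _ _ Hf' Hgx'))
  (differentiable_near_plus _ _ _ _ _ (IHn _ _ Hfy' Hg') (IHn _ _ Hf' Hgy'))).
- apply: locally_2d_impl Hfx; apply: locally_2d_impl Hgx; apply: locally_2d_forall => u v Hg1 Hf1.
  by apply: (is_derive_mult (fun z => f z v) (fun z => g z v)) => // *; apply: Rmult_comm.
- apply: locally_2d_impl Hfy; apply: locally_2d_impl Hgy; apply: locally_2d_forall => u v Hg1 Hf1.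
  by apply: (is_derive_mult (fun z => f u z) (fun z => g u z)) => // *; apply: Rmult_comm.
Qed.

Lemma differentiable_near_inv (n : nat) (f : R -> R -> R) (x y : R) :
  differentiable_near n f x y -> f x y <> 0 ->
  differentiable_near n (fun u v => / f u v) x y.
Proof.
move=> Hf f0.
have nz : locally_2d (fun u v => f u v <> 0) x y.
  apply: continuity_2d_pt_neq_0 => //.
  exact: locally_2d_singleton (differentiable_near_continuity _ _ _ _ Hf).
have cc : locally_2d (continuity_2d_pt (fun u v => / f u v)) x y.
  apply: locally_2d_impl (differentiable_near_continuity _ _ _ _ Hf).
  apply: locally_2d_impl nz.
  by apply: locally_2d_forall => u v nz cf; exact: continuity_2d_pt_inv.
elim: n Hf => [|n IHn] Hf; first by apply: locally_2d_impl cc; apply: locally_2d_forall.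
have [Hfx Hfx'] := differentiable_near_x _ _ _ _ Hf.
have [Hfy Hfy'] := differentiable_near_y _ _ _ _ Hf.
have Hi := IHn (differentiable_near_le _ _ _ _ _ (leqnSn n) Hf).
(* The derivative of 1/f is written f' * (-1 * (1/f * 1/f)), so that order [n] follows from products
   and the induction hypothesis for 1/f itself. *)
have H2 := differentiable_near_mult _ _ _ _ _ (differentiable_near_const n (-1) x y)
  (differentiable_near_mult _ _ _ _ _ Hi Hi).
apply: (differentiable_near_S _ _ _ _ _ _ _ _ cc
  (differentiable_near_mult _ _ _ _ _ Hfx' H2) (differentiable_near_mult _ _ _ _ _ Hfy' H2)).
- apply: locally_2d_impl Hfx; apply: locally_2d_impl nz; apply: locally_2d_forall => u v nz Hf1.
  evar_last; first exact: (is_derive_inv (fun z => f z v) u _ Hf1).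
  by rewrite /=; field.
- apply: locally_2d_impl Hfy; apply: locally_2d_impl nz; apply: locally_2d_forall => u v nz Hf1.
  evar_last; first exact: (is_derive_inv (fun z => f u z) v _ Hf1).
  by rewrite /=; field.
Qed.

(** Continuity of a partial derivative upgrades the existence of both partial derivatives to total
    differentiability, the form that the chain rule in two variables requires. *)
Lemma differentiable_near_pt_lim (n : nat) (f : R -> R -> R) (x y : R) :
  differentiable_near n.+1 f x y ->
  differentiable_pt_lim f x y (Derive (fun z => f z y) x) (Derive (fun z => f x z) y).
Proof.
move=> Hf.
have [Hfx Hfx'] := differentiable_near_x _ _ _ _ Hf.
have [Hfy _] := differentiable_near_y _ _ _ _ Hf.
apply/filterdiff_differentiable_pt_lim.
apply: (is_derive_filterdiff f x y (fun u v => Derive (fun z => f z v) u)).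
- by move/locally_2d_locally: Hfx.
- exact: (locally_2d_singleton _ _ _ Hfy).
- have /continuity_2d_pt_filterlim :=
    locally_2d_singleton _ _ _ (differentiable_near_continuity _ _ _ _ Hfx').
  exact.
Qed.

Lemma differentiable_near_comp (n : nat) (h f g : R -> R -> R) (x y : R) :
  differentiable_near n h (f x y) (g x y) ->
  differentiable_near n f x y -> differentiable_near n g x y ->
  differentiable_near n (fun u v => h (f u v) (g u v)) x y.
Proof.
move=> + Hf Hg.
have pull P : locally_2d P (f x y) (g x y) -> locally_2d (fun u v => P (f u v) (g u v)) x y.
  apply: locally_2d_preimage.
  - exact: locally_2d_singleton (differentiable_near_continuity _ _ _ _ Hf).
  - exact: locally_2d_singleton (differentiable_near_continuity _ _ _ _ Hg).
have cc k : differentiable_near 0 k (f x y) (g x y) ->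
    locally_2d (continuity_2d_pt (fun u v => k (f u v) (g u v))) x y.
  move=> /differentiable_near_continuity /pull ck.
  apply: locally_2d_impl (differentiable_near_continuity _ _ _ _ Hf).
  apply: locally_2d_impl (differentiable_near_continuity _ _ _ _ Hg).
  apply: locally_2d_impl ck.
  by apply: locally_2d_forall => u v ? ? ?; exact: continuity_2d_pt_comp.
elim: n h Hf Hg => [|n IHn] h Hf Hg Hh.
  by apply: locally_2d_impl (cc _ Hh); apply: locally_2d_forall.
have [Hfx Hfx'] := differentiable_near_x _ _ _ _ Hf.
have [Hfy Hfy'] := differentiable_near_y _ _ _ _ Hf.
have [Hgx Hgx'] := differentiable_near_x _ _ _ _ Hg.
have [Hgy Hgy'] := differentiable_near_y _ _ _ _ Hg.
have [_ Hhx'] := differentiable_near_x _ _ _ _ Hh.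
have [_ Hhy'] := differentiable_near_y _ _ _ _ Hh.
have Hf' := differentiable_near_le _ _ _ _ _ (leqnSn n) Hf.
have Hg' := differentiable_near_le _ _ _ _ _ (leqnSn n) Hg.
have Hx := IHn _ Hf' Hg' Hhx'; have Hy := IHn _ Hf' Hg' Hhy'.
(* Total differentiability of [h] holds at all points near the image point; [pull] brings it back
   along the continuous map (f, g). *)
have dh : locally_2d (fun u v => differentiable_pt_lim h (f u v) (g u v)
   (Derive (fun z => h z (g u v)) (f u v)) (Derive (fun z => h (f u v) z) (g u v))) x y.
  apply: (pull (fun a b => differentiable_pt_lim h a b
    (Derive (fun z => h z b) a) (Derive (fun z => h a z) b))).
  apply: locally_2d_impl (locally_2d_idem _ _ _ Hh); apply: locally_2d_forall => u v.
  exact: differentiable_near_pt_lim.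
have c0 := cc _ (differentiable_near_le 0 _ _ _ _ (leq0n _) Hh).
apply: (differentiable_near_S _ _ _ _ _ _ _ _ c0
  (differentiable_near_plus _ _ _ _ _ (differentiable_near_mult _ _ _ _ _ Hx Hfx')
     (differentiable_near_mult _ _ _ _ _ Hy Hgx'))
  (differentiable_near_plus _ _ _ _ _ (differentiable_near_mult _ _ _ _ _ Hx Hfy')
     (differentiable_near_mult _ _ _ _ _ Hy Hgy'))).
- apply: locally_2d_impl Hfx; apply: locally_2d_impl Hgx; apply: locally_2d_impl dh.
  apply: locally_2d_forall => u v H1 Hg1 Hf1.
  apply/is_derive_Reals.
  apply: (derivable_pt_lim_comp_2d h (fun z => f z v) (fun z => g z v)) => //.
  - exact/is_derive_Reals.
  - exact/is_derive_Reals.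
- apply: locally_2d_impl Hfy; apply: locally_2d_impl Hgy; apply: locally_2d_impl dh.
  apply: locally_2d_forall => u v H1 Hg1 Hf1.
  apply/is_derive_Reals.
  apply: (derivable_pt_lim_comp_2d h (fun z => f u z) (fun z => g u z)) => //.
  - exact/is_derive_Reals.
  - exact/is_derive_Reals.
Qed.

(** [smooth_germ] fixes one neighbourhood for all orders, while the closure lemmas above may shrink
    theirs with [n]. Stated at each point of the fixed neighbourhood, the shrinking is harmless. *)
Lemma smooth_germP (h : R -> R -> R) :
  smooth_germ h <->
  locally_2d (fun x y => forall n : nat, differentiable_near n h x y) 0 0.
Proof.
split.
  move=> /locally_2d_idem; apply: locally_2d_impl; apply: locally_2d_forall => x y H n.
  by apply: locally_2d_impl H; apply: locally_2d_forall => u v; apply.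
apply: locally_2d_impl; apply: locally_2d_forall => x y H n.
exact: locally_2d_singleton (H n).
Qed.

(** * Jets of order four in one variable *)

Lemma ball_Rabs (x y : R) (e : posreal) : ball x e y <-> Rabs (y - x) < e.
Proof. by []. Qed.

(** This is O(s^5) at 0, the remainder of a 4-jet. No regularity of [f] is asked, so remainders can
    be added and multiplied without differentiating. *)
Definition negligible (f : R -> R) : Prop :=
  exists D, locally 0 (fun s => Rabs (f s) <= D * Rabs s ^ 5).

Definition bounded_near0 (f : R -> R) : Prop :=
  exists M, locally 0 (fun s => Rabs (f s) <= M).

Lemma negligible_ext_near (f g : R -> R) :
  locally 0 (fun s => f s = g s) -> negligible f -> negligible g.
Proof.
move=> Hfg [D HD]; exists D.
by apply: filter_imp (filter_and _ _ Hfg HD) => s [<-].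
Qed.

Lemma negligible_ext (f g : R -> R) :
  (forall s, f s = g s) -> negligible f -> negligible g.
Proof. by move=> Hfg; apply: negligible_ext_near; apply: filter_forall. Qed.

Lemma negligible_plus (f g : R -> R) :
  negligible f -> negligible g -> negligible (fun s => f s + g s).
Proof.
move=> [D HD] [E HE]; exists (D + E).
apply: filter_imp (filter_and _ _ HD HE) => s [H1 H2].
have := Rabs_triang (f s) (g s); lra.
Qed.

Lemma negligible_mult (f g : R -> R) :
  bounded_near0 f -> negligible g -> negligible (fun s => f s * g s).
Proof.
move=> [M HM] [E HE]; exists (M * E).
apply: filter_imp (filter_and _ _ HM HE) => s [H1 H2].
rewrite Rabs_mult Rmult_assoc.
by apply: Rmult_le_compat => //; apply: Rabs_pos.
Qed.

Lemma bounded_near0_continuous (f : R -> R) : continuous f 0 -> bounded_near0 f.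
Proof.
move=> cf; exists (Rabs (f 0) + 1).
have H : locally 0 (fun s => ball (f 0) (mkposreal 1 Rlt_0_1) (f s)) := cf _ (locally_ball _ _).
apply: filter_imp H => s /ball_Rabs /= H.
have := Rabs_triang (f s - f 0) (f 0).
have -> : f s - f 0 + f 0 = f s by ring.
lra.
Qed.

Lemma bounded_near0_plus (f g : R -> R) :
  bounded_near0 f -> bounded_near0 g -> bounded_near0 (fun s => f s + g s).
Proof.
move=> [M HM] [N HN]; exists (M + N).
apply: filter_imp (filter_and _ _ HM HN) => s [H1 H2].
have := Rabs_triang (f s) (g s); lra.
Qed.

Lemma negligible_bounded (f : R -> R) : negligible f -> bounded_near0 f.
Proof.
(* The sign of [D] is unknown, hence the maximum with 0. *)
move=> [D HD]; exists (Rmax 0 D).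
apply: filter_imp (filter_and _ _ HD (locally_ball 0 (mkposreal 1 Rlt_0_1))) => s [H] /ball_Rabs.
rewrite Rminus_0_r /= => Hs.
apply: Rle_trans H _.
have p0 : 0 <= Rabs s ^ 5 by apply: pow_le; apply: Rabs_pos.
have p1 : Rabs s ^ 5 <= 1.
  by rewrite -[X in _ <= X](pow1 5); apply: pow_incr; have := Rabs_pos s; lra.
have := Rmax_l 0 D; have := Rmax_r 0 D; nra.
Qed.

Record jet : Type := Jet { j0 : R; j1 : R; j2 : R; j3 : R; j4 : R }.

Definition jeval (c : jet) (s : R) : R :=
  j0 c + j1 c * s + j2 c * s ^ 2 + j3 c * s ^ 3 + j4 c * s ^ 4.

Definition has_jet (f : R -> R) (c : jet) : Prop :=
  negligible (fun s => f s - jeval c s).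

Definition jconst (k : R) : jet := Jet k 0 0 0 0.

Definition jadd (c d : jet) : jet :=
  Jet (j0 c + j0 d) (j1 c + j1 d) (j2 c + j2 d) (j3 c + j3 d) (j4 c + j4 d).

Definition jmul (c d : jet) : jet :=
  Jet (j0 c * j0 d)
      (j0 c * j1 d + j1 c * j0 d)
      (j0 c * j2 d + j1 c * j1 d + j2 c * j0 d)
      (j0 c * j3 d + j1 c * j2 d + j2 c * j1 d + j3 c * j0 d)
      (j0 c * j4 d + j1 c * j3 d + j2 c * j2 d + j3 c * j1 d + j4 c * j0 d).

Lemma bounded_near0_poly (c : jet) : bounded_near0 (jeval c).
Proof.
apply: bounded_near0_continuous; apply: ex_derive_continuous.
by rewrite /jeval; auto_derive.
Qed.

Lemma has_jet_bounded (f : R -> R) (c : jet) : has_jet f c -> bounded_near0 f.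
Proof.
move=> /negligible_bounded Hf.
have [M HM] := bounded_near0_plus _ _ Hf (bounded_near0_poly c).
exists M; apply: filter_imp HM => s.
by have -> : f s - jeval c s + jeval c s = f s by ring.
Qed.

Lemma has_jet_ext_near (f g : R -> R) (c : jet) :
  locally 0 (fun s => f s = g s) -> has_jet f c -> has_jet g c.
Proof.
move=> H; apply: negligible_ext_near.
by apply: filter_imp H => s ->.
Qed.

Lemma has_jet_ext (f g : R -> R) (c : jet) :
  (forall s, f s = g s) -> has_jet f c -> has_jet g c.
Proof. by move=> H; apply: has_jet_ext_near; apply: filter_forall. Qed.

Lemma has_jet_jeval (c : jet) : has_jet (jeval c) c.
Proof.
exists 0; apply: filter_forall => s.
by rewrite Rminus_diag Rabs_R0; lra.
Qed.

Lemma has_jet_const (k : R) : has_jet (fun _ => k) (jconst k).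
Proof.
by apply: has_jet_ext (has_jet_jeval (jconst k)) => s; rewrite /jeval /=; ring.
Qed.

Lemma has_jet_add (f g : R -> R) (c d : jet) :
  has_jet f c -> has_jet g d -> has_jet (fun s => f s + g s) (jadd c d).
Proof.
move=> Hf Hg; apply: negligible_ext (negligible_plus _ _ Hf Hg) => s.
by rewrite /jeval /=; ring.
Qed.

(** f g - c d = g (f - c) + c (g - d), each summand bounded times negligible. The polynomial [q]
    collects the terms of degree 5 to 8 of c d, divided by s^5, that [jmul] truncates. *)
Lemma has_jet_mul (f g : R -> R) (c d : jet) :
  has_jet f c -> has_jet g d -> has_jet (fun s => f s * g s) (jmul c d).
Proof.
move=> Hf Hg.
have H1 := negligible_mult _ _ (has_jet_bounded _ _ Hg) Hf.
have H2 := negligible_mult _ _ (bounded_near0_poly c) Hg.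
pose q s := (j1 c * j4 d + j2 c * j3 d + j3 c * j2 d + j4 c * j1 d)
  + (j2 c * j4 d + j3 c * j3 d + j4 c * j2 d) * s
  + (j3 c * j4 d + j4 c * j3 d) * s ^ 2 + j4 c * j4 d * s ^ 3.
have H3 : negligible (fun s => q s * s ^ 5).
  apply: negligible_mult.
    apply: bounded_near0_continuous; apply: ex_derive_continuous.
    by rewrite /q; auto_derive.
  by exists 1; apply: filter_forall => s; rewrite -RPow_abs Rmult_1_l; apply: Rle_refl.
apply: negligible_ext (negligible_plus _ _ (negligible_plus _ _ H1 H2) H3) => s.
by rewrite /q /jeval /=; ring.
Qed.

Lemma has_jet_scal (f : R -> R) (k : R) (c : jet) :
  has_jet f c -> has_jet (fun s => k * f s) (jmul (jconst k) c).
Proof. by move=> Hf; apply: has_jet_mul => //; apply: has_jet_const. Qed.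

(** Dividing by s^k leaves |g s| <= D s^(5 - k), which tends to 0. If g 0 were nonzero, a small
    explicit s would give both |g s| >= |g 0| / 2 and |g s| <= |g 0| / 4. *)
Lemma negligible_factor (k : nat) (g : R -> R) :
  (k < 5)%N -> continuous g 0 -> negligible (fun s => s ^ k * g s) -> g 0 = 0.
Proof.
move=> lt_k5 cg [D HD].
have [//|g0] := Req_dec (g 0) 0; exfalso.
have e0 : 0 < Rabs (g 0) / 2 by have := Rabs_pos_lt _ g0; lra.
have H : locally 0 (fun s => ball (g 0) (mkposreal _ e0) (g s)) := cg _ (locally_ball _ _).
have [d Hd] := filter_and _ _ HD H.
pose E := Rabs D + 1.
have E1 : 1 <= E by rewrite /E; have := Rabs_pos D; lra.
have ED : D <= E by rewrite /E; have := Rle_abs D; lra.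
(* The three bounds keep s inside the neighbourhood, make s^(m+1) <= s, and give E s <= |g 0| /
   4. *)
pose s := Rmin (d / 2) (Rmin (1 / 2) (Rabs (g 0) / (4 * E))).
have dpos := cond_pos d.
have s0 : 0 < s.
  apply: Rmin_glb_lt; first by lra.
  apply: Rmin_glb_lt; first by lra.
  by apply: Rdiv_lt_0_compat; [exact: Rabs_pos_lt | lra].
have sd : s <= d / 2 by exact: Rmin_l.
have s1 : s <= 1 / 2 by apply: Rle_trans (Rmin_r _ _) (Rmin_l _ _).
have sg : s <= Rabs (g 0) / (4 * E) by apply: Rle_trans (Rmin_r _ _) (Rmin_r _ _).
have bs : ball 0 d s.
  by apply/ball_Rabs; rewrite Rminus_0_r Rabs_pos_eq; lra.
have [] := Hd s bs.
rewrite Rabs_mult => H1 /ball_Rabs /= H2.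
have H3 : Rabs (g 0) / 2 <= Rabs (g s).
  have := Rabs_triang (g s - g 0) (- g s).
  have -> : g s - g 0 + - g s = - g 0 by ring.
  by rewrite !Rabs_Ropp; lra.
have sk : 0 < s ^ k by exact: pow_lt.
rewrite -RPow_abs (Rabs_pos_eq s) in H1; last by lra.
have [m Hm] : exists m, (5 = k + m.+1)%N.
  by exists (5 - k).-1; rewrite prednK ?subn_gt0 // subnKC // ltnW.
rewrite Hm -plusE pow_add in H1.
have H4 : Rabs (g s) <= D * s ^ m.+1.
  by apply: (Rmult_le_reg_l (s ^ k)) => //; lra.
have H5 : s ^ m.+1 <= s.
  rewrite /=; have : s ^ m <= 1 by rewrite -[X in _ <= X](pow1 m); apply: pow_incr; lra.
  nra.
have H6 : D * s ^ m.+1 <= E * s.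
  apply: (Rle_trans _ (E * s ^ m.+1)); first by apply: Rmult_le_compat_r => //; apply: pow_le; lra.
  by apply: Rmult_le_compat_l => //; lra.
have H7 : E * s <= Rabs (g 0) / 4.
  have -> : Rabs (g 0) / 4 = E * (Rabs (g 0) / (4 * E)) by field; lra.
  by apply: Rmult_le_compat_l => //; lra.
lra.
Qed.

Lemma negligible_jeval_factor (k : nat) (c : jet) :
  (k < 5)%N -> negligible (fun s => s ^ k * jeval c s) -> j0 c = 0.
Proof.
move=> lt_k5 H.
have -> : j0 c = jeval c 0 by rewrite /jeval /=; ring.
apply: negligible_factor H => //.
by apply: ex_derive_continuous; rewrite /jeval; auto_derive.
Qed.

(** Lowest degree first: once the coefficients below degree k vanish, s^k factors out and the next
    one is the value at 0 of the cofactor. *)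
Lemma has_jet0 (c : jet) : has_jet (fun _ => 0) c -> c = jconst 0.
Proof.
case: c => a0 a1 a2 a3 a4 H.
have {}H : negligible (jeval (Jet a0 a1 a2 a3 a4)).
  have [D HD] := H; exists D; apply: filter_imp HD => s.
  by rewrite Rminus_0_l Rabs_Ropp.
have a00 : a0 = 0.
  apply: (negligible_jeval_factor 0 (Jet a0 a1 a2 a3 a4)) => //.
  by apply: negligible_ext H => s; rewrite /jeval /=; ring.
have a10 : a1 = 0.
  apply: (negligible_jeval_factor 1 (Jet a1 a2 a3 a4 0)) => //.
  by apply: negligible_ext H => s; rewrite a00 /jeval /=; ring.
have a20 : a2 = 0.
  apply: (negligible_jeval_factor 2 (Jet a2 a3 a4 0 0)) => //.
  by apply: negligible_ext H => s; rewrite a00 a10 /jeval /=; ring.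
have a30 : a3 = 0.
  apply: (negligible_jeval_factor 3 (Jet a3 a4 0 0 0)) => //.
  by apply: negligible_ext H => s; rewrite a00 a10 a20 /jeval /=; ring.
have a40 : a4 = 0.
  apply: (negligible_jeval_factor 4 (Jet a4 0 0 0 0)) => //.
  by apply: negligible_ext H => s; rewrite a00 a10 a20 a30 /jeval /=; ring.
by rewrite a00 a10 a20 a30 a40.
Qed.

(** This turns an identity between functions of s into identities between coefficients; it is
    applied to the graph equation and to restrictions to lines. *)
Lemma has_jet_unique (f : R -> R) (c d : jet) : has_jet f c -> has_jet f d -> c = d.
Proof.
move=> Hc Hd.
have Hd' := has_jet_scal _ (-1) _ Hd.
have := has_jet0 _ (has_jet_ext _ (fun _ => 0) _ _ (has_jet_add _ _ _ _ Hc Hd')).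
case: c Hc => c0 c1 c2 c3 c4 _; case: d Hd Hd' => d0 d1 d2 d3 d4 _ _ /=.
rewrite /jadd /jconst /= => /(_ (fun _ => ltac:(ring))) [] *.
by congr Jet; lra.
Qed.

(** * Taylor polynomials of degree four in two variables, composed with jets of curves *)

Definition taylor_coef (f : R -> R -> R) (i j : nat) : R :=
  partial_derive i j f 0 0 / (INR (Factorial.fact i) * INR (Factorial.fact j)).

Definition quartic (T : nat -> nat -> R) (x y : R) : R :=
  T 0%N 0%N + (T 1%N 0%N * x + T 0%N 1%N * y)
  + (T 2%N 0%N * x ^ 2 + T 1%N 1%N * (x * y) + T 0%N 2%N * y ^ 2)
  + (T 3%N 0%N * x ^ 3 + T 2%N 1%N * (x ^ 2 * y) + T 1%N 2%N * (x * y ^ 2)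
     + T 0%N 3%N * y ^ 3)
  + (T 4%N 0%N * x ^ 4 + T 3%N 1%N * (x ^ 3 * y) + T 2%N 2%N * (x ^ 2 * y ^ 2)
     + T 1%N 3%N * (x * y ^ 3) + T 0%N 4%N * y ^ 4).

(* The jet of [quartic T] along curves through the origin: the constant terms of x and y
   are taken to be 0. *)
Definition jquartic (T : nat -> nat -> R) (x y : jet) : jet :=
  let: Jet _ x1 x2 x3 x4 := x in let: Jet _ y1 y2 y3 y4 := y in
  let t1 x y := T 1%N 0%N * x + T 0%N 1%N * y in
  let t2 xx xy yy := T 2%N 0%N * xx + T 1%N 1%N * xy + T 0%N 2%N * yy in
  let t3 xxx xxy xyy yyy :=
    T 3%N 0%N * xxx + T 2%N 1%N * xxy + T 1%N 2%N * xyy + T 0%N 3%N * yyy in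
  Jet (T 0%N 0%N)
    (t1 x1 y1)
    (t1 x2 y2 + t2 (x1 ^ 2) (x1 * y1) (y1 ^ 2))
    (t1 x3 y3 + t2 (2 * x1 * x2) (x1 * y2 + x2 * y1) (2 * y1 * y2)
     + t3 (x1 ^ 3) (x1 ^ 2 * y1) (x1 * y1 ^ 2) (y1 ^ 3))
    (t1 x4 y4
     + t2 (x2 ^ 2 + 2 * x1 * x3) (x1 * y3 + x2 * y2 + x3 * y1) (y2 ^ 2 + 2 * y1 * y3)
     + t3 (3 * x1 ^ 2 * x2) (2 * x1 * x2 * y1 + x1 ^ 2 * y2)
          (x2 * y1 ^ 2 + 2 * x1 * y1 * y2) (3 * y1 ^ 2 * y2)
     + (T 4%N 0%N * x1 ^ 4 + T 3%N 1%N * (x1 ^ 3 * y1) + T 2%N 2%N * (x1 ^ 2 * y1 ^ 2)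
        + T 1%N 3%N * (x1 * y1 ^ 3) + T 0%N 4%N * y1 ^ 4)).

Lemma jaddE (c0 c1 c2 c3 c4 d0 d1 d2 d3 d4 : R) :
  jadd (Jet c0 c1 c2 c3 c4) (Jet d0 d1 d2 d3 d4)
  = Jet (c0 + d0) (c1 + d1) (c2 + d2) (c3 + d3) (c4 + d4).
Proof. by []. Qed.

Lemma jscalE (k c0 c1 c2 c3 c4 : R) :
  jmul (jconst k) (Jet c0 c1 c2 c3 c4)
  = Jet (k * c0) (k * c1) (k * c2) (k * c3) (k * c4).
Proof. by rewrite /jmul /=; congr Jet; ring. Qed.

Lemma jmul_vanishing (c1 c2 c3 c4 d1 d2 d3 d4 : R) :
  jmul (Jet 0 c1 c2 c3 c4) (Jet 0 d1 d2 d3 d4)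
  = Jet 0 0 (c1 * d1) (c1 * d2 + c2 * d1) (c1 * d3 + c2 * d2 + c3 * d1).
Proof. by rewrite /jmul /=; congr Jet; ring. Qed.

Lemma has_jet_quartic (T : nat -> nat -> R) (f g : R -> R) (c d : jet) :
  has_jet f c -> has_jet g d -> j0 c = 0 -> j0 d = 0 ->
  has_jet (fun s => quartic T (f s) (g s)) (jquartic T c d).
Proof.
case: c => c0 c1 c2 c3 c4; case: d => d0 d1 d2 d3 d4 Hf Hg /= c00 d00.
rewrite {c0}c00 in Hf; rewrite {d0}d00 in Hg.
(* One jet for each monomial of degree 2, 3 and 4 in f and g, built by multiplying a lower one by f
   or g. *)
have := has_jet_mul _ _ _ _ Hf Hf; rewrite jmul_vanishing => Hff.
have := has_jet_mul _ _ _ _ Hf Hg; rewrite jmul_vanishing => Hfg.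
have := has_jet_mul _ _ _ _ Hg Hg; rewrite jmul_vanishing => Hgg.
have := has_jet_mul _ _ _ _ Hf Hff; rewrite jmul_vanishing => Hfff.
have := has_jet_mul _ _ _ _ Hf Hfg; rewrite jmul_vanishing => Hffg.
have := has_jet_mul _ _ _ _ Hf Hgg; rewrite jmul_vanishing => Hfgg.
have := has_jet_mul _ _ _ _ Hg Hgg; rewrite jmul_vanishing => Hggg.
have := has_jet_mul _ _ _ _ Hf Hfff; rewrite jmul_vanishing => Hffff.
have := has_jet_mul _ _ _ _ Hf Hffg; rewrite jmul_vanishing => Hfffg.
have := has_jet_mul _ _ _ _ Hf Hfgg; rewrite jmul_vanishing => Hffgg.
have := has_jet_mul _ _ _ _ Hf Hggg; rewrite jmul_vanishing => Hfggg.
have := has_jet_mul _ _ _ _ Hg Hggg; rewrite jmul_vanishing => Hgggg.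
have A := has_jet_add; have S k h e := has_jet_scal h k e.
have H1 := A _ _ _ _ (has_jet_const (T 0%N 0%N))
  (A _ _ _ _ (S (T 1%N 0%N) _ _ Hf) (S (T 0%N 1%N) _ _ Hg)).
have H2 := A _ _ _ _ (A _ _ _ _ (S (T 2%N 0%N) _ _ Hff) (S (T 1%N 1%N) _ _ Hfg))
  (S (T 0%N 2%N) _ _ Hgg).
have H3 := A _ _ _ _ (A _ _ _ _ (A _ _ _ _ (S (T 3%N 0%N) _ _ Hfff) (S (T 2%N 1%N) _ _ Hffg))
  (S (T 1%N 2%N) _ _ Hfgg)) (S (T 0%N 3%N) _ _ Hggg).
have H4 := A _ _ _ _ (A _ _ _ _ (A _ _ _ _ (A _ _ _ _ (S (T 4%N 0%N) _ _ Hffff)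
  (S (T 3%N 1%N) _ _ Hfffg)) (S (T 2%N 2%N) _ _ Hffgg)) (S (T 1%N 3%N) _ _ Hfggg))
  (S (T 0%N 4%N) _ _ Hgggg).
have := A _ _ _ _ (A _ _ _ _ (A _ _ _ _ H1 H2) H3) H4.
rewrite !jscalE /jconst !jaddE; set c := Jet _ _ _ _ _ => H.
have : has_jet (fun s => quartic T (f s) (g s)) c.
  by apply: has_jet_ext H => s; rewrite /quartic; ring.
by congr has_jet; rewrite /c /jquartic; congr Jet; ring.
Qed.

(** Taylor-Lagrange: five orders of differentiability bound the remainder after degree 4. *)
Lemma taylor_quartic (f : R -> R -> R) :
  differentiable_near 5 f 0 0 ->
  exists D, locally_2d (fun x y =>
    Rabs (f x y - quartic (taylor_coef f) x y) <= D * Rmax (Rabs x) (Rabs y) ^ 5) 0 0.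
Proof.
move=> Hf.
have [D HD] : DL_regular_n f 4 0 0 by exact: Taylor_Lagrange_2d.
exists D; apply: locally_2d_impl HD; apply: locally_2d_forall => x y.
rewrite !Rminus_0_r.
have -> // : DL_pol 4 f 0 0 x y = quartic (taylor_coef f) x y.
rewrite /DL_pol /differential /quartic /taylor_coef /Binomial.C /=; field.
Qed.

Lemma has_jet_order1 (f : R -> R) (c : jet) :
  has_jet f c -> j0 c = 0 -> exists M, locally 0 (fun s => Rabs (f s) <= M * Rabs s).
Proof.
move=> [D HD] c0.
(* With zero constant term the jet is s times the jet shifted down by one degree. *)
have [N HN] := bounded_near0_poly (Jet (j1 c) (j2 c) (j3 c) (j4 c) 0).
have [M HM] : bounded_near0 (fun s => D * s ^ 4).
  by apply: bounded_near0_continuous; apply: ex_derive_continuous; auto_derive.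
exists (M + N); apply: filter_imp (filter_and _ _ HD (filter_and _ _ HN HM)) => s [H1 [H2 H3]].
have -> : f s = (f s - jeval c s) + s * jeval (Jet (j1 c) (j2 c) (j3 c) (j4 c) 0) s.
  by rewrite /jeval /= c0; ring.
apply: Rle_trans (Rabs_triang _ _) _.
rewrite Rmult_plus_distr_r; apply: Rplus_le_compat.
  apply: Rle_trans H1 _.
  have p4 : 0 <= Rabs s ^ 4 by apply: pow_le; apply: Rabs_pos.
  have : D * Rabs s ^ 4 <= M.
    by rewrite Rabs_mult -RPow_abs in H3; have := Rle_abs D; nra.
  by have := Rabs_pos s; rewrite /=; nra.
by rewrite Rabs_mult Rmult_comm; apply: Rmult_le_compat_r => //; apply: Rabs_pos.
Qed.

(** Since g and h are O(s), the Taylor remainder of [f], of size max(|g|, |h|)^5, is O(s^5); what is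
    left is the quartic evaluated on jets. *)
Lemma has_jet_comp (f : R -> R -> R) (g h : R -> R) (c d : jet) :
  differentiable_near 5 f 0 0 -> has_jet g c -> has_jet h d -> j0 c = 0 -> j0 d = 0 ->
  has_jet (fun s => f (g s) (h s)) (jquartic (taylor_coef f) c d).
Proof.
move=> /taylor_quartic [D [e He]] Hg Hh c0 d0.
have [M HM] := has_jet_order1 _ _ Hg c0.
have [N HN] := has_jet_order1 _ _ Hh d0.
suff Hr : has_jet (fun s => f (g s) (h s) - quartic (taylor_coef f) (g s) (h s)) (jconst 0).
  apply: negligible_ext (negligible_plus _ _ Hr
    (has_jet_quartic (taylor_coef f) _ _ _ _ Hg Hh c0 d0)) => s.
  by rewrite /jeval /=; ring.
(* |g s| and |h s| are both at most K |s|, so |s| < e / K puts (g s, h s) where the Taylor estimate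
   holds. *)
pose K := Rabs M + Rabs N + 1.
have K1 : 1 <= K by rewrite /K; have := Rabs_pos M; have := Rabs_pos N; lra.
have MK : M <= K by rewrite /K; have := Rle_abs M; have := Rabs_pos N; lra.
have NK : N <= K by rewrite /K; have := Rle_abs N; have := Rabs_pos M; lra.
have ek : 0 < e / K by apply: Rdiv_lt_0_compat; [exact: cond_pos | lra].
exists (Rabs D * K ^ 5).
apply: filter_imp (filter_and _ _ (locally_ball 0 (mkposreal _ ek)) (filter_and _ _ HM HN)).
move=> s [/ball_Rabs]; rewrite Rminus_0_r /= => Hs [H1 H2].
have s0 := Rabs_pos s.
have Ks : K * Rabs s < e.
  have -> : (e : R) = K * (e / K) by field; lra.
  by apply: Rmult_lt_compat_l => //; lra.
have {}H1 : Rabs (g s) <= K * Rabs s by nra.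
have {}H2 : Rabs (h s) <= K * Rabs s by nra.
have := He (g s) (h s); rewrite !Rminus_0_r => /(_ ltac:(lra) ltac:(lra)) H.
have -> : jeval (jconst 0) s = 0 by rewrite /jeval /=; ring.
rewrite Rminus_0_r; apply: Rle_trans H _.
have -> : Rabs D * (K * (K * (K * (K * (K * 1)))))
    * (Rabs s * (Rabs s * (Rabs s * (Rabs s * (Rabs s * 1)))))
  = Rabs D * (K * Rabs s) ^ 5 by ring.
have m0 : 0 <= Rmax (Rabs (g s)) (Rabs (h s)) by apply: Rle_trans (Rabs_pos (g s)) (Rmax_l _ _).
have m5 := pow_le _ 5 m0.
apply: (Rle_trans _ (Rabs D * Rmax (Rabs (g s)) (Rabs (h s)) ^ 5)).
  by apply: Rmult_le_compat_r => //; exact: Rle_abs.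
apply: Rmult_le_compat_l; first exact: Rabs_pos.
by apply: pow_incr; split=> //; apply: Rmax_lub.
Qed.

Lemma has_jet_line (a : R) : has_jet (fun s => a * s) (Jet 0 a 0 0 0).
Proof. by apply: has_jet_ext (has_jet_jeval _) => s; rewrite /jeval /=; ring. Qed.

(** * Smooth germs and their restrictions to lines *)

Lemma smooth_germ_differentiable_near (n : nat) (f : R -> R -> R) :
  smooth_germ f -> differentiable_near n f 0 0.
Proof. by move=> /smooth_germP /locally_2d_singleton; apply. Qed.

Lemma smooth_germ_continuity (f : R -> R -> R) :
  smooth_germ f -> continuity_2d_pt f 0 0.
Proof. by move=> /locally_2d_singleton /(_ 0%N) []. Qed.

Lemma smooth_germ_const (c : R) : smooth_germ (fun _ _ => c).
Proof.
by apply/smooth_germP; apply: locally_2d_forall => x y n; exact: differentiable_near_const.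
Qed.

Lemma smooth_germ_fst : smooth_germ (fun x _ => x).
Proof.
by apply/smooth_germP; apply: locally_2d_forall => x y n; exact: differentiable_near_fst.
Qed.

Lemma smooth_germ_snd : smooth_germ (fun _ y => y).
Proof.
by apply/smooth_germP; apply: locally_2d_forall => x y n; exact: differentiable_near_snd.
Qed.

Lemma smooth_germ_plus (f g : R -> R -> R) :
  smooth_germ f -> smooth_germ g -> smooth_germ (fun x y => f x y + g x y).
Proof.
move=> /smooth_germP Hf /smooth_germP Hg; apply/smooth_germP.
apply: locally_2d_impl Hf; apply: locally_2d_impl Hg; apply: locally_2d_forall => x y Hg Hf n.
exact: differentiable_near_plus.
Qed.

Lemma smooth_germ_mult (f g : R -> R -> R) :
  smooth_germ f -> smooth_germ g -> smooth_germ (fun x y => f x y * g x y).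
Proof.
move=> /smooth_germP Hf /smooth_germP Hg; apply/smooth_germP.
apply: locally_2d_impl Hf; apply: locally_2d_impl Hg; apply: locally_2d_forall => x y Hg Hf n.
exact: differentiable_near_mult.
Qed.

Lemma smooth_germ_pow (f : R -> R -> R) (n : nat) :
  smooth_germ f -> smooth_germ (fun x y => f x y ^ n).
Proof.
move=> Hf; elim: n => [|n IHn]; first exact: smooth_germ_const.
exact: smooth_germ_mult.
Qed.

Lemma smooth_germ_inv (f : R -> R -> R) :
  smooth_germ f -> f 0 0 <> 0 -> smooth_germ (fun x y => / f x y).
Proof.
move=> Hf f0; apply/smooth_germP.
have nz := continuity_2d_pt_neq_0 _ _ _ (smooth_germ_continuity _ Hf) f0.
move/smooth_germP: Hf => Hf.
apply: locally_2d_impl nz; apply: locally_2d_impl Hf; apply: locally_2d_forall => x y Hf nz n.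
exact: differentiable_near_inv.
Qed.

Lemma smooth_germ_comp (h f g : R -> R -> R) :
  smooth_germ h -> smooth_germ f -> smooth_germ g -> f 0 0 = 0 -> g 0 0 = 0 ->
  smooth_germ (fun x y => h (f x y) (g x y)).
Proof.
move=> /smooth_germP Hh Hf Hg f0 g0; apply/smooth_germP.
have {}Hh : locally_2d (fun x y => forall n, differentiable_near n h (f x y) (g x y)) 0 0.
  apply: (locally_2d_preimage (fun a b => forall n, differentiable_near n h a b)).
  - exact: smooth_germ_continuity.
  - exact: smooth_germ_continuity.
  - by rewrite f0 g0.
move/smooth_germP: Hf => Hf; move/smooth_germP: Hg => Hg.
apply: locally_2d_impl Hf; apply: locally_2d_impl Hg; apply: locally_2d_impl Hh.
apply: locally_2d_forall => x y Hh Hg Hf n.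
exact: differentiable_near_comp.
Qed.

Lemma partial_derive_taylor_coef (f : R -> R -> R) (i j : nat) :
  partial_derive i j f 0 0
  = taylor_coef f i j * (INR (Factorial.fact i) * INR (Factorial.fact j)).
Proof.
by rewrite /taylor_coef; field; split; apply: INR_fact_neq_0.
Qed.

Lemma order_gt_taylor_coef (k i j : nat) (f : R -> R -> R) :
  order_gt k f -> (i + j <= k)%N -> taylor_coef f i j = 0.
Proof. by move=> [_ H] /H; rewrite /taylor_coef => ->; rewrite /Rdiv Rmult_0_l. Qed.

Lemma quartic_eq0 (p0 p1 p2 p3 p4 : R) :
  (forall t, p0 + p1 * t + p2 * t ^ 2 + p3 * t ^ 3 + p4 * t ^ 4 = 0) ->
  [/\ p0 = 0, p1 = 0, p2 = 0, p3 = 0 & p4 = 0].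
Proof.
move=> H; have := H 0; have := H 1; have := H (-1); have := H 2; have := H (-2).
by split; lra.
Qed.

(** The coefficient of s^d on the line of slope b is a polynomial in b whose coefficients are the
    Taylor coefficients of total degree d. Vanishing for every b kills them all. *)
Lemma order_gt4_lines (h : R -> R -> R) :
  smooth_germ h -> (forall b, has_jet (fun s => h s (b * s)) (jconst 0)) ->
  order_gt 4 h.
Proof.
move=> Hs Hl; split=> // i j le_ij.
have Hd := smooth_germ_differentiable_near 5 _ Hs.
have E b := has_jet_unique _ _ _ (Hl b)
  (has_jet_comp _ _ _ _ _ Hd
    (has_jet_ext _ (fun s => s) _ (fun s => Rmult_1_l s) (has_jet_line 1))
    (has_jet_line b) erefl erefl).
rewrite partial_derive_taylor_coef.
suff -> : taylor_coef h i j = 0 by rewrite Rmult_0_l.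
move: E; set T := taylor_coef h.
rewrite /jquartic /jconst => E.
(* The conjuncts [0 = 0] pad a polynomial in b of lower degree to the five coefficients of
   [quartic_eq0]. *)
have [T00 _ _ _ _] : [/\ T 0%N 0%N = 0, 0 = 0, 0 = 0, 0 = 0 & 0 = 0].
  by apply: quartic_eq0 => b; have [+ _ _ _ _] := E b; lra.
have [T10 T01 _ _ _] : [/\ T 1%N 0%N = 0, T 0%N 1%N = 0, 0 = 0, 0 = 0 & 0 = 0].
  by apply: quartic_eq0 => b; have [_ + _ _ _] := E b; lra.
have [T20 T11 T02 _ _] : [/\ T 2%N 0%N = 0, T 1%N 1%N = 0, T 0%N 2%N = 0, 0 = 0 & 0 = 0].
  by apply: quartic_eq0 => b; have [_ _ + _ _] := E b; lra.
have [T30 T21 T12 T03 _] :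
    [/\ T 3%N 0%N = 0, T 2%N 1%N = 0, T 1%N 2%N = 0, T 0%N 3%N = 0 & 0 = 0].
  by apply: quartic_eq0 => b; have [_ _ _ + _] := E b; lra.
have [T40 T31 T22 T13 T04] : [/\ T 4%N 0%N = 0, T 3%N 1%N = 0, T 2%N 2%N = 0,
    T 1%N 3%N = 0 & T 0%N 4%N = 0].
  by apply: quartic_eq0 => b; have [_ _ _ _ +] := E b; lra.
by case: i le_ij => [|[|[|[|[|i]]]]]; case: j => [|[|[|[|[|j]]]]].
Qed.

(* Only for jets with constant term 1. *)
Definition jinv (c : jet) : jet :=
  Jet 1 (- j1 c) (j1 c ^ 2 - j2 c) (- j1 c ^ 3 + 2 * j1 c * j2 c - j3 c)
    (j1 c ^ 4 - 3 * j1 c ^ 2 * j2 c + 2 * j1 c * j3 c + j2 c ^ 2 - j4 c).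

(** 1/f - jinv c = (1/f) (1 - f * jinv c): the second factor is negligible, and the first is bounded
    by 2 because f >= 1/2 near 0. *)
Lemma has_jet_inv (f : R -> R) (c : jet) :
  has_jet f c -> j0 c = 1 -> has_jet (fun s => / f s) (jinv c).
Proof.
move=> Hf c0.
have [M HM] : exists M, locally 0 (fun s => Rabs (f s + -1) <= M * Rabs s).
  apply: (has_jet_order1 (fun s => f s + -1) (jadd c (jconst (-1)))).
    exact: has_jet_add Hf (has_jet_const (-1)).
  by rewrite /= c0; lra.
have K0 : 0 < / (2 * (Rabs M + 1)).
  by apply: Rinv_0_lt_compat; have := Rabs_pos M; lra.
have f12 : locally 0 (fun s => 1 / 2 <= f s).
  apply: filter_imp (filter_and _ _ HM (locally_ball 0 (mkposreal _ K0))) => s [H /ball_Rabs].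
  rewrite Rminus_0_r /= => Hs.
  have M1 : 0 < Rabs M + 1 by have := Rabs_pos M; lra.
  have : (Rabs M + 1) * Rabs s <= 1 / 2.
    have -> : 1 / 2 = (Rabs M + 1) * / (2 * (Rabs M + 1)) by field; lra.
    by apply: Rmult_le_compat_l; lra.
  have : M * Rabs s <= (Rabs M + 1) * Rabs s.
    by apply: Rmult_le_compat_r; [exact: Rabs_pos | have := Rle_abs M; lra].
  by move: H; rewrite /Rabs; case: Rcase_abs; lra.
have bi : bounded_near0 (fun s => / f s).
  exists 2; apply: filter_imp f12 => s H.
  rewrite Rabs_pos_eq; last by apply: Rlt_le; apply: Rinv_0_lt_compat; lra.
  rewrite -(Rinv_inv 2); apply: Rinv_le_contravar; lra.
have H1 : has_jet (fun s => 1 + (-1) * (f s * jeval (jinv c) s)) (jconst 0).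
  have := has_jet_add _ _ _ _ (has_jet_const 1)
    (has_jet_scal _ (-1) _ (has_jet_mul _ _ _ _ Hf (has_jet_jeval (jinv c)))).
  congr has_jet; rewrite /jadd /jmul /jconst /jinv /= c0; congr Jet; ring.
apply: negligible_ext_near (negligible_mult _ _ bi H1).
apply: filter_imp f12 => s H.
by rewrite /jeval /=; field; lra.
Qed.

(** * Taylor coefficients of ruled surfaces *)

Lemma locally_2d_shift (P : R -> Prop) (u0 : R) :
  locally u0 P -> locally_2d (fun s _ => P (u0 + s)) 0 0.
Proof.
move=> [d Hd]; exists d => s t; rewrite Rminus_0_r => Hs _.
by apply/Hd/ball_Rabs; have -> : u0 + s - u0 = s by ring.
Qed.

Lemma is_derive_shift (f : R -> R) (u0 s : R) :
  ex_derive f (u0 + s) -> is_derive (fun t => f (u0 + t)) s (Derive f (u0 + s)).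
Proof.
move=> Hf; evar_last.
  apply: (is_derive_comp f (fun t => u0 + t)); first exact: Derive_correct.
  by auto_derive.
by rewrite /scal /= /mult /=; ring.
Qed.

Lemma differentiable_near_shift (f : R -> R) (u0 : R) (n : nat) :
  (forall k, locally u0 (fun u => ex_derive_n f k u)) ->
  differentiable_near n (fun s _ => f (u0 + s)) 0 0.
Proof.
elim: n f => [|n IHn] f Hf.
all: have H1 := locally_2d_shift _ _ (Hf 1%N).
all: have cf : locally_2d (continuity_2d_pt (fun s _ => f (u0 + s))) 0 0.
1,3: apply: locally_2d_impl H1; apply: locally_2d_forall => s t H1.
1,2: apply: (continuity_1d_2d_pt_comp (fun s => f (u0 + s)) (fun s _ => s));
  last exact: continuity_2d_pt_id1.
1,2: apply/continuity_pt_filterlim; apply: ex_derive_continuous;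
  by eexists; apply: is_derive_shift.
  by apply: locally_2d_impl cf; apply: locally_2d_forall.
apply: (differentiable_near_S _ _ (fun s _ => Derive f (u0 + s)) (fun _ _ => 0)) => //.
- by apply: locally_2d_impl H1; apply: locally_2d_forall => s t; exact: is_derive_shift.
- by apply: locally_2d_forall => s t; apply: is_derive_const.
- apply: (IHn (Derive f)) => k.
  apply: filter_imp (Hf k.+1) => u; case: k => [|k] //= H.
  apply: ex_derive_ext H => v.
  by have := Derive_n_comp f k 1 v; rewrite PeanoNat.Nat.add_1_r.
- exact: differentiable_near_const.
Qed.

(** The vector coefficient of s^k in c(u0 + s). Each coordinate is treated as a function of two
    variables constant in the second, so that [has_jet_comp] also serves for curves. *)
Definition curve_taylor (c : R -> vec4) (u0 : R) (k : nat) : vec4 :=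
  (\row_i taylor_coef (fun s _ => crd (c (Rplus u0 s)) i) k 0)%R.

Lemma curve_taylor0 (c : R -> vec4) (u0 : R) (i : 'I_4) :
  crd (curve_taylor c u0 0) i = crd (c u0) i.
Proof.
rewrite /curve_taylor /crd mxE /taylor_coef /partial_derive /=.
by rewrite Rplus_0_r /Rdiv Rmult_1_l Rinv_1 Rmult_1_r.
Qed.

Lemma locally_in_interval (a b : Rbar) (u0 : R) :
  in_interval a b u0 -> locally u0 (in_interval a b).
Proof.
move=> [au ub]; apply: filter_and.
- by apply: (open_Rbar_gt' u0 a).
- by apply: (open_Rbar_lt' u0 b).
Qed.

Lemma smooth_curve_locally (a b : Rbar) (c : R -> vec4) (u0 : R) :
  smooth_curve a b c -> in_interval a b u0 ->
  forall i k, locally u0 (fun u => ex_derive_n (fun v => crd (c v) i) k u).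
Proof.
move=> Hc /locally_in_interval Hu i k.
by apply: filter_imp Hu => u; exact: Hc.
Qed.

Lemma curve_taylor1 (a b : Rbar) (c : R -> vec4) (u0 : R) :
  smooth_curve a b c -> in_interval a b u0 ->
  curve_taylor c u0 1 = dcurve c u0.
Proof.
move=> Hc Hu; apply/rowP => i; rewrite !mxE /taylor_coef /partial_derive /=.
have -> : Derive (fun t => crd (c (u0 + t)) i) 0 = Derive (fun v => crd (c v) i) (u0 + 0).
  apply: is_derive_unique; apply: (is_derive_shift (fun v => crd (c v) i)).
  by rewrite Rplus_0_r; exact: (Hc i 1%N).
by rewrite Rplus_0_r; field.
Qed.

Lemma has_jet_curve (a b : Rbar) (c : R -> vec4) (u0 : R) (i : 'I_4) (al : R) :
  smooth_curve a b c -> in_interval a b u0 ->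
  let k n := crd (curve_taylor c u0 n) i in
  has_jet (fun s => crd (c (u0 + al * s)) i)
    (Jet (k 0%N) (al * k 1%N) (al ^ 2 * k 2%N) (al ^ 3 * k 3%N) (al ^ 4 * k 4%N)).
Proof.
move=> Hc Hu k.
pose f s (_ : R) := crd (c (u0 + s)) i.
have kE n : k n = taylor_coef f n 0 by rewrite /k /curve_taylor /crd mxE.
have Hd : differentiable_near 5 f 0 0.
  exact: (differentiable_near_shift _ _ 5 (smooth_curve_locally _ _ _ _ Hc Hu i)).
have := has_jet_comp _ _ _ _ _ Hd (has_jet_line al) (has_jet_const 0) erefl erefl.
by congr has_jet; rewrite /jquartic /jconst !kE; congr Jet; ring.
Qed.

Lemma crd_mulmx (v : vec4) (A : 'M[R]_4) (j : 'I_4) :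
  crd (v *m A)%R j
  = crd v ix * A ix j + crd v iy * A iy j + crd v iz * A iz j + crd v iw * A iw j.
Proof.
rewrite /crd mxE !big_ord_recl big_ord0 /=.
have -> : lift ord0 (ord0 : 'I_3) = iy by apply: val_inj.
have -> : lift ord0 (lift ord0 (ord0 : 'I_2)) = iz by apply: val_inj.
have -> : lift ord0 (lift ord0 (lift ord0 (ord0 : 'I_1))) = iw by apply: val_inj.
have -> : (ord0 : 'I_4) = ix by apply: val_inj.
rewrite -!RplusE -!RmultE -R0E; ring.
Qed.

Lemma crd_add (v w : vec4) (i : 'I_4) : crd (v + w)%R i = crd v i + crd w i.
Proof. by rewrite /crd mxE. Qed.

Lemma crd_opp (v : vec4) (i : 'I_4) : crd (- v)%R i = - crd v i.
Proof. by rewrite /crd mxE. Qed.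

Lemma crd_scale (k : R) (v : vec4) (i : 'I_4) : crd (k *: v)%R i = k * crd v i.
Proof. by rewrite /crd mxE. Qed.

(** Here the rulings enter: F is affine in t, so along the line of direction (al, be) in the
    parameter plane the coefficient of s^n contains be to the power at most one. *)
Lemma has_jet_ruled_coord (a b : Rbar) (x e : R -> vec4) (u0 t0 : R)
    (A : 'M[R]_4) (j : 'I_4) (al be : R) :
  smooth_curve a b x -> smooth_curve a b e -> in_interval a b u0 ->
  let P n := crd ((curve_taylor x u0 n + t0 *: curve_taylor e u0 n) *m A)%R j in
  let E n := crd (curve_taylor e u0 n *m A)%R j in
  has_jet (fun s => crd (affine_coords A (ruled_map x e u0 t0)
                           (ruled_map x e (u0 + al * s) (t0 + be * s))) j)
    (Jet 0 (al * P 1%N + be * E 0%N)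
      (al ^ 2 * P 2%N + al * be * E 1%N)
      (al ^ 3 * P 3%N + al ^ 2 * be * E 2%N)
      (al ^ 4 * P 4%N + al ^ 3 * be * E 3%N)).
Proof.
move=> Hx He Hu P E.
have Ht : has_jet (fun s => t0 + be * s) (Jet t0 be 0 0 0).
  by apply: has_jet_ext (has_jet_jeval _) => s; rewrite /jeval /=; ring.
pose kx n i := crd (curve_taylor x u0 n) i; pose ke n i := crd (curve_taylor e u0 n) i.
have Hi i : has_jet
    (fun s => crd (ruled_map x e (u0 + al * s) (t0 + be * s) - ruled_map x e u0 t0)%R i)
    (Jet 0 (al * (kx 1%N i + t0 * ke 1%N i) + be * ke 0%N i)
      (al ^ 2 * (kx 2%N i + t0 * ke 2%N i) + al * be * ke 1%N i)
      (al ^ 3 * (kx 3%N i + t0 * ke 3%N i) + al ^ 2 * be * ke 2%N i)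
      (al ^ 4 * (kx 4%N i + t0 * ke 4%N i) + al ^ 3 * be * ke 3%N i)).
  have := has_jet_add _ _ _ _ (has_jet_add _ _ _ _ (has_jet_curve _ _ _ _ i al Hx Hu)
    (has_jet_mul _ _ _ _ Ht (has_jet_curve _ _ _ _ i al He Hu)))
    (has_jet_const (- (kx 0%N i + t0 * ke 0%N i))).
  rewrite -/(kx _ _) -/(ke _ _) /jmul /jadd /jconst => H.
  apply: (has_jet_ext _ _ _ _ (eq_ind _ (has_jet _) H _ _)).
    move=> s; rewrite /ruled_map crd_add crd_opp !crd_add !crd_scale /kx /ke.
    by rewrite !curve_taylor0.
  by congr Jet; rewrite /kx /ke /=; ring.
have HA i := has_jet_scal _ (A i j) _ (Hi i).
have := has_jet_add _ _ _ _ (has_jet_add _ _ _ _ (has_jet_add _ _ _ _ (HA ix) (HA iy))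
  (HA iz)) (HA iw).
rewrite !jscalE !jaddE /P /E !crd_mulmx !crd_add !crd_scale -/(kx _ _).
set c := Jet _ _ _ _ _ => H; set d := Jet _ _ _ _ _.
have -> : d = c.
  by rewrite /c /d /kx /ke; congr Jet; ring.
by apply: has_jet_ext H => s; rewrite /affine_coords crd_mulmx; ring.
Qed.

(* The first jet is X, the second Y, the right-hand side Z, each affine in t along the
   rulings; varying (al, be) separates the monomials of each order. *)
Lemma ruling_relations (T : nat -> nat -> R)
    (a1 a2 a3 a4 b1 b2 b3 c1 c2 c3 c4 d0 d1 d2 d3 z1 z2 z3 z4 w1 w2 w3 : R) :
  T 0%N 0%N = 0 -> T 1%N 0%N = 0 -> T 0%N 1%N = 0 -> a1 <> 0 -> d0 <> 0 ->
  (forall al be, jquartic T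
    (Jet 0 (al * a1) (al ^ 2 * a2 + al * be * b1) (al ^ 3 * a3 + al ^ 2 * be * b2)
       (al ^ 4 * a4 + al ^ 3 * be * b3))
    (Jet 0 (al * c1 + be * d0) (al ^ 2 * c2 + al * be * d1) (al ^ 3 * c3 + al ^ 2 * be * d2)
       (al ^ 4 * c4 + al ^ 3 * be * d3))
    = Jet 0 z1 (al ^ 2 * z2 + al * be * w1) (al ^ 3 * z3 + al ^ 2 * be * w2)
        (al ^ 4 * z4 + al ^ 3 * be * w3)) ->
  let k := - b1 / (a1 * d0) in
  let lam := - (b1 * d1 + b2 * d0 + k * (2 * a1 * d0 * d1 + 2 * b1 * d0 * c1 + a2 * d0 ^ 2)
                + 3 * a1 * d0 ^ 2 * c1 * k ^ 2) / (a1 ^ 2 * d0 ^ 2) in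
  [/\ z2 = T 2%N 0%N * a1 ^ 2 + T 1%N 1%N * (a1 * c1), w1 = T 1%N 1%N * (a1 * d0),
      [/\ T 0%N 2%N = 0, T 0%N 3%N = 0 & T 0%N 4%N = 0] &
      [/\ T 1%N 2%N = k * T 1%N 1%N, T 1%N 3%N = k ^ 2 * T 1%N 1%N &
          T 2%N 2%N = 2 * k * T 2%N 1%N - k ^ 2 * T 2%N 0%N + lam * T 1%N 1%N]].
Proof.
move=> T00 T10 T01 a10 d00 H k lam.
move: H; rewrite /jquartic T00 T10 T01 => H.
(* For al = 0 the curve is the ruling through p, along which only the pure powers of y survive. *)
have [_ H2 H3 H4] := H 0 1.
have T02 : T 0%N 2%N = 0.
  by apply: (Rmult_eq_reg_r (d0 ^ 2)); [lra | exact: pow_nonzero].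
have T03 : T 0%N 3%N = 0.
  rewrite T02 in H3.
  by apply: (Rmult_eq_reg_r (d0 ^ 3)); [lra | exact: pow_nonzero].
have T04 : T 0%N 4%N = 0.
  rewrite T02 T03 in H4.
  by apply: (Rmult_eq_reg_r (d0 ^ 4)); [lra | exact: pow_nonzero].
move: H; rewrite T02 T03 T04 => H {H2 H3 H4}.
(* With al = 1 each coefficient is a polynomial in be; the values 0, 1, -1, 2, -2 determine it. *)
have [_ A2 A3 A4] := H 1 0.
have [_ B2 B3 B4] := H 1 1.
have [_ C2 C3 C4] := H 1 (-1).
have [_ _ _ D4] := H 1 2.
have [_ _ _ E4] := H 1 (-2).
(* [F3], [F4] and [G4] are the coefficients of al be^2, al be^3 and al^2 be^2. Solving them produces
   [k] and [lam], which involve only the jets of X and Y. *)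
have F3 : T 1%N 2%N * (a1 * d0 ^ 2) + T 1%N 1%N * (b1 * d0) = 0 by lra.
have F4 : T 1%N 3%N * (a1 * d0 ^ 3) + T 1%N 2%N * (b1 * d0 ^ 2) = 0 by lra.
have G4 : T 2%N 2%N * (a1 ^ 2 * d0 ^ 2) + T 2%N 0%N * b1 ^ 2
  + T 1%N 1%N * (b1 * d1 + b2 * d0) + T 2%N 1%N * (2 * a1 * b1 * d0)
  + T 1%N 2%N * (2 * a1 * d0 * d1 + 2 * b1 * d0 * c1 + a2 * d0 ^ 2)
  + T 1%N 3%N * (3 * a1 * d0 ^ 2 * c1) = 0 by lra.
have kE : b1 = - k * (a1 * d0) by rewrite /k; field.
have T12 : T 1%N 2%N = k * T 1%N 1%N.
  apply: (Rmult_eq_reg_r (a1 * d0 ^ 2)); first by rewrite kE in F3; lra.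
  by apply: Rmult_integral_contrapositive_currified => //; exact: pow_nonzero.
have T13 : T 1%N 3%N = k ^ 2 * T 1%N 1%N.
  apply: (Rmult_eq_reg_r (a1 * d0 ^ 3)); first by rewrite kE T12 in F4; lra.
  by apply: Rmult_integral_contrapositive_currified => //; exact: pow_nonzero.
split=> //.
- lra.
- lra.
split=> //.
have lE : lam * (a1 ^ 2 * d0 ^ 2) =
  - (b1 * d1 + b2 * d0 + k * (2 * a1 * d0 * d1 + 2 * b1 * d0 * c1 + a2 * d0 ^ 2)
                + 3 * a1 * d0 ^ 2 * c1 * k ^ 2) by rewrite /lam; field.
apply: (Rmult_eq_reg_r (a1 ^ 2 * d0 ^ 2)); last first.
  by apply: Rmult_integral_contrapositive_currified; exact: pow_nonzero.
transitivity ((2 * k * T 2%N 1%N - k ^ 2 * T 2%N 0%N) * (a1 ^ 2 * d0 ^ 2)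
  + T 1%N 1%N * (lam * (a1 ^ 2 * d0 ^ 2))); last by ring.
rewrite lE.
rewrite T12 T13 in G4.
have b2E : b1 ^ 2 = k ^ 2 * (a1 ^ 2 * d0 ^ 2) by rewrite kE; ring.
have abE : 2 * a1 * b1 * d0 = - 2 * k * (a1 ^ 2 * d0 ^ 2) by rewrite kE; ring.
rewrite b2E abE in G4.
lra.
Qed.

(** * Projective normalization *)

Lemma jmul_vanishing_unit (c1 c2 c3 c4 d1 d2 d3 d4 : R) :
  jmul (Jet 0 c1 c2 c3 c4) (Jet 1 d1 d2 d3 d4)
  = Jet 0 c1 (c1 * d1 + c2) (c1 * d2 + c2 * d1 + c3) (c1 * d3 + c2 * d2 + c3 * d1 + c4).
Proof. by rewrite /jmul /=; congr Jet; ring. Qed.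

(* The values of p4 and p3 cancel the coefficients of x^2 y^2 and x^3 y in the second
   component; G40, G31, T40 are what is then left in the coefficients of x^4, x^3 y and of
   x^4. Everything is linear in (l, m), so that one computation serves both components. *)
Lemma projective_normal_form (f : R -> R -> R) (l m k lam r s r' s' A B C D : R) :
  smooth_germ f ->
  let T := taylor_coef f in
  [/\ T 0%N 0%N = 0, T 1%N 0%N = 0 & T 0%N 1%N = 0] ->
  [/\ T 2%N 0%N = l, T 1%N 1%N = m & T 0%N 2%N = 0] ->
  [/\ T 3%N 0%N = l * r + m * s, T 2%N 1%N = l * r' + m * s',
      T 1%N 2%N = k * m & T 0%N 3%N = 0] ->
  [/\ T 4%N 0%N = l * A + m * B, T 3%N 1%N = l * C + m * D,
      T 2%N 2%N = 2 * k * (l * r' + m * s') - k ^ 2 * l + lam * m,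
      T 1%N 3%N = k ^ 2 * m & T 0%N 4%N = 0] ->
  let p4 := lam + 2 * k * r - r * r' - k * s' in
  let p3 := D - r' * s - s' ^ 2 - 2 * k * s in
  let G40 := A - p3 - r ^ 2 - r' * s in
  let G31 := C - p4 + k * r - 2 * r * r' - r' * s' in
  let T40 := B - r * s - s * s' in
  let g1 X Y := X ^ 2 + G40 * X ^ 4 + G31 * X ^ 3 * Y in
  let g2 X Y := X * Y + T40 * X ^ 4 in
  let p X Y := 1 + (r * X + (2 * k - r') * Y + p3 * g1 X Y + p4 * g2 X Y) in
  order_gt 4 (fun X Y => (l * g1 X Y + m * g2 X Y) / p X Y
    - f ((X + (k - r') * g2 X Y) / p X Y)
        ((Y + - s * g1 X Y + (r - s') * g2 X Y) / p X Y)).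
Proof.
move=> Hf T [T00 T10 T01] [T20 T11 T02] [T30 T21 T12 T03] [T40' T31 T22 T13 T04].
move=> p4 p3 G40 G31 T40 g1 g2 p.
have sg1 : smooth_germ g1.
  by repeat first [exact: smooth_germ_const | exact: smooth_germ_fst | exact: smooth_germ_snd
    | apply: smooth_germ_plus | apply: smooth_germ_pow | apply: smooth_germ_mult].
have sg2 : smooth_germ g2.
  by repeat first [exact: smooth_germ_const | exact: smooth_germ_fst | exact: smooth_germ_snd
    | apply: smooth_germ_plus | apply: smooth_germ_pow | apply: smooth_germ_mult].
have sip : smooth_germ (fun X Y => / p X Y).
  apply: smooth_germ_inv.
    by repeat first [exact: smooth_germ_const | exact: smooth_germ_fst | exact: smooth_germ_snd
      | exact: sg1 | exact: sg2 | apply: smooth_germ_plus | apply: smooth_germ_mult].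
  by rewrite /p /g1 /g2; have -> : forall a b c d, 1 + (a * 0 + b * 0
    + c * (0 ^ 2 + G40 * 0 ^ 4 + G31 * 0 ^ 3 * 0) + d * (0 * 0 + T40 * 0 ^ 4)) = 1
    by move=> *; ring.
apply: order_gt4_lines.
  have -> : (fun X Y => (l * g1 X Y + m * g2 X Y) / p X Y
    - f ((X + (k - r') * g2 X Y) / p X Y)
        ((Y + - s * g1 X Y + (r - s') * g2 X Y) / p X Y))
   = (fun X Y => (l * g1 X Y + m * g2 X Y) / p X Y
    + (-1) * f ((X + (k - r') * g2 X Y) / p X Y)
        ((Y + - s * g1 X Y + (r - s') * g2 X Y) / p X Y)).
    apply: FunctionalExtensionality.functional_extensionality => X.
    by apply: FunctionalExtensionality.functional_extensionality => Y; ring.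
  have sc := smooth_germ_const.
  apply: smooth_germ_plus.
    by do 2 ?[apply: smooth_germ_mult | apply: smooth_germ_plus] => //; apply: smooth_germ_mult.
  apply: smooth_germ_mult; first exact: sc.
  apply: smooth_germ_comp => //.
  - apply: smooth_germ_mult => //; apply: smooth_germ_plus; first exact: smooth_germ_fst.
    exact: smooth_germ_mult.
  - apply: smooth_germ_mult => //; apply: smooth_germ_plus; last exact: smooth_germ_mult.
    apply: smooth_germ_plus; first exact: smooth_germ_snd.
    exact: smooth_germ_mult.
  - by rewrite /Rdiv /g2; ring.
  - by rewrite /Rdiv /g1 /g2; ring.
move=> b.
(* On the line Y = b X, [g1], [g2] and [p] are polynomials of degree at most 4 in t, so their jets
   are exact. *)
pose G := G40 + G31 * b.
have jg1 : has_jet (fun t => g1 t (b * t)) (Jet 0 0 1 0 G).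
  by apply: has_jet_ext (has_jet_jeval _) => t; rewrite /g1 /G /jeval /=; ring.
have jg2 : has_jet (fun t => g2 t (b * t)) (Jet 0 0 b 0 T40).
  by apply: has_jet_ext (has_jet_jeval _) => t; rewrite /g2 /jeval /=; ring.
pose P1 := r + (2 * k - r') * b; pose P2 := p3 + p4 * b; pose P4 := p3 * G + p4 * T40.
have jp : has_jet (fun t => p t (b * t)) (Jet 1 P1 P2 0 P4).
  apply: has_jet_ext (has_jet_jeval _) => t.
  by rewrite /p /g1 /g2 /P1 /P2 /P4 /G /jeval /=; ring.
have {jp} := has_jet_inv _ _ jp erefl; rewrite /jinv.
cbn [j0 j1 j2 j3 j4] => jip.
have jX : has_jet (fun t => t + (k - r') * g2 t (b * t))
   (Jet 0 1 ((k - r') * b) 0 ((k - r') * T40)).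
  by apply: has_jet_ext (has_jet_jeval _) => t; rewrite /g2 /jeval /=; ring.
have jY : has_jet (fun t => b * t + - s * g1 t (b * t) + (r - s') * g2 t (b * t))
   (Jet 0 b (- s + (r - s') * b) 0 (- s * G + (r - s') * T40)).
  by apply: has_jet_ext (has_jet_jeval _) => t; rewrite /g1 /g2 /G /jeval /=; ring.
have jZ : has_jet (fun t => l * g1 t (b * t) + m * g2 t (b * t))
   (Jet 0 0 (l + m * b) 0 (l * G + m * T40)).
  by apply: has_jet_ext (has_jet_jeval _) => t; rewrite /g1 /g2 /G /jeval /=; ring.
have := has_jet_mul _ _ _ _ jX jip; rewrite jmul_vanishing_unit => {}jX.
have := has_jet_mul _ _ _ _ jY jip; rewrite jmul_vanishing_unit => {}jY.
have := has_jet_mul _ _ _ _ jZ jip; rewrite jmul_vanishing_unit => {}jZ.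
have := has_jet_comp _ _ _ _ _ (smooth_germ_differentiable_near 5 _ Hf) jX jY erefl erefl.
rewrite -/T /jquartic T00 T10 T01 T20 T11 T02 T30 T21 T12 T03 T40' T31 T22 T13 T04 => jF.
have := has_jet_add _ _ _ _ jZ (has_jet_scal _ (-1) _ jF).
rewrite jscalE jaddE; set c := Jet _ _ _ _ _ => H.
(* The whole normalization is this polynomial identity: with the chosen parameters, the coefficients
   of t^2, t^3 and t^4 cancel identically in b. *)
have -> : jconst 0 = c.
  rewrite /c /jconst /P1 /P2 /P4 /G /G40 /G31 /T40 /p3 /p4.
  by congr Jet; ring.
by apply: has_jet_ext H => t; rewrite /Rdiv; ring.
Qed.

(** * Monge forms of ruled surfaces *)

Lemma locally_2d_line (P : R -> R -> Prop) (u0 t0 al be : R) :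
  locally_2d P u0 t0 -> locally 0 (fun s => P (u0 + al * s) (t0 + be * s)).
Proof.
move=> [d Hd].
pose K := Rabs al + Rabs be + 1.
have K1 : 1 <= K by rewrite /K; have := Rabs_pos al; have := Rabs_pos be; lra.
have dK : 0 < d / K by apply: Rdiv_lt_0_compat; [exact: cond_pos | lra].
exists (mkposreal _ dK) => s /ball_Rabs; rewrite Rminus_0_r /= => Hs.
have Ks : K * Rabs s < d.
  have -> : (d : R) = K * (d / K) by field; lra.
  by apply: Rmult_lt_compat_l => //; lra.
have s0 := Rabs_pos s.
apply: Hd.
- have -> : u0 + al * s - u0 = al * s by ring.
  by rewrite Rabs_mult; move: Ks; rewrite /K; have := Rabs_pos be; nra.
- have -> : t0 + be * s - t0 = be * s by ring.
  by rewrite Rabs_mult; move: Ks; rewrite /K; have := Rabs_pos al; nra.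
Qed.

Lemma vec4_eqP (v w : vec4) :
  crd v ix = crd w ix -> crd v iy = crd w iy -> crd v iz = crd w iz -> crd v iw = crd w iw ->
  v = w.
Proof.
move=> Hx Hy Hz Hw; apply/rowP => i.
case: i => [[|[|[|[|i]]]] Hi] //.
- by rewrite (_ : Ordinal Hi = ix) //; apply: val_inj.
- by rewrite (_ : Ordinal Hi = iy) //; apply: val_inj.
- by rewrite (_ : Ordinal Hi = iz) //; apply: val_inj.
- by rewrite (_ : Ordinal Hi = iw) //; apply: val_inj.
Qed.

Lemma crd0 (i : 'I_4) : crd 0%R i = 0.
Proof. by rewrite /crd mxE. Qed.

Lemma unitmx4P (Q : 'M[R]_4) :
  (forall v : vec4, (v *m Q)%R = 0%R -> v = 0%R) -> Q \in unitmx.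
Proof.
move=> H; rewrite -row_free_unit -kermx_eq0; apply/rowV0P => v /sub_kermxP.
exact: H.
Qed.

(** The Taylor coefficients of u |-> F(u, t0), the curve on the surface with t frozen. *)
Definition ruled_taylor (x e : R -> vec4) (u0 t0 : R) (n : nat) : vec4 :=
  (curve_taylor x u0 n + t0 *: curve_taylor e u0 n)%R.

Lemma ruled_taylor1 (a b : Rbar) (x e : R -> vec4) (u0 t0 : R) :
  ruled_surface a b x e -> in_interval a b u0 ->
  ruled_taylor x e u0 t0 1 = dcurve (fun u => ruled_map x e u t0) u0.
Proof.
move=> [Hx He _ _] Hu; rewrite /ruled_taylor (curve_taylor1 _ _ _ _ Hx Hu).
rewrite (curve_taylor1 _ _ _ _ He Hu); apply/rowP => i; rewrite !mxE.
symmetry; apply: is_derive_unique.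
apply: (is_derive_ext (fun u => crd (x u) i + t0 * crd (e u) i)).
  by move=> u; rewrite /ruled_map crd_add crd_scale.
apply: (is_derive_plus (fun u => crd (x u) i) (fun u => t0 * crd (e u) i)).
  exact: Derive_correct (Hx i 1%N u0 Hu).
apply: is_derive_scal.
exact: Derive_correct (He i 1%N u0 Hu).
Qed.

Lemma curve_taylor0E (c : R -> vec4) (u0 : R) : curve_taylor c u0 0 = c u0.
Proof. by apply/rowP => i; apply: curve_taylor0. Qed.

Section Monge.

Variables (a b : Rbar) (x e : R -> vec4) (u0 t0 : R) (A : 'M[R]_4) (f1 f2 : R -> R -> R).
Hypothesis Hruled : ruled_surface a b x e.
Hypothesis Hu : in_interval a b u0.
Hypothesis Hmonge : monge_form x e u0 t0 A f1 f2.

Let P n := (ruled_taylor x e u0 t0 n *m A)%R.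
Let E n := (curve_taylor e u0 n *m A)%R.

(** [A] is invertible and e(u0) is nonzero, so the coordinates of e(u0) cannot all vanish, and the
    y-axis leaves only one. *)
Lemma monge_form_dir_coords :
  [/\ crd (E 0) ix = 0, crd (E 0) iy <> 0, crd (E 0) iz = 0 & crd (E 0) iw = 0].
Proof.
have E0 i : i != iy -> crd (E 0) i = 0.
  by rewrite /E curve_taylor0E; exact: (monge_ruling Hmonge).
split; [exact: E0 | | exact: E0 | exact: E0] => Ey.
have eA : (e u0 *m A)%R = 0%R.
  by rewrite -curve_taylor0E -/(E 0); apply: vec4_eqP; rewrite crd0 ?Ey ?E0.
apply: (ruled_dir_neq0 Hruled Hu).
by rewrite -(mulmxK (monge_affine Hmonge) (e u0)) eA mul0mx.
Qed.

(** If F_u had zero x-coordinate it would be a multiple of e, placing x' in the span of e and e',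
    against non-developability. *)
Lemma monge_form_tangent_coords :
  [/\ crd (P 1) ix <> 0, crd (P 1) iz = 0 & crd (P 1) iw = 0].
Proof.
have P1 i : i \in [:: iz; iw] -> crd (P 1) i = 0.
  by rewrite /P (ruled_taylor1 _ _ _ _ _ _ Hruled Hu); exact: (monge_tangent Hmonge).
have [Ex Ey Ez Ew] := monge_form_dir_coords.
split; [| exact: P1 | exact: P1] => Px.
pose c := crd (P 1) iy / crd (E 0) iy.
have PE : P 1 = (c *: E 0)%R.
  apply: vec4_eqP; rewrite crd_scale.
  - by rewrite Px Ex Rmult_0_r.
  - by rewrite /c; field.
  - by rewrite (P1 iz) // Ez Rmult_0_r.
  - by rewrite (P1 iw) // Ew Rmult_0_r.
have : ruled_taylor x e u0 t0 1 = (c *: e u0)%R.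
  rewrite -(mulmxK (monge_affine Hmonge) (ruled_taylor x e u0 t0 1)) -/(P 1) PE.
  by rewrite -scalemxAl /E curve_taylor0E mulmxK // (monge_affine Hmonge).
have [Hx He _ /(_ _ Hu)] := Hruled.
rewrite /ruled_taylor (curve_taylor1 _ _ _ _ Hx Hu) (curve_taylor1 _ _ _ _ He Hu).
rewrite free_cons => /andP[/negP Hn _] H; apply: Hn.
have -> : dcurve x u0 = (c *: e u0 - t0 *: dcurve e u0)%R by rewrite -H GRing.addrK.
by apply: memvB; apply: memvZ; apply: memv_span; rewrite !inE eqxx ?orbT.
Qed.

(** The constants [k] and [lam] are chosen before the component, hence shared by f1 and f2. The
    formulas for [P 2] and [E 1], the normal coordinates of F_uu / 2 and F_ut, allow two Monge forms
    to be compared. *)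
Lemma monge_form_taylor :
  exists k lam, forall f j, (f = f1 /\ j = iz) \/ (f = f2 /\ j = iw) ->
  let T := taylor_coef f in
  [/\ smooth_germ f /\ [/\ T 0%N 0%N = 0, T 1%N 0%N = 0 & T 0%N 1%N = 0],
      crd (P 2) j = T 2%N 0%N * crd (P 1) ix ^ 2 + T 1%N 1%N * (crd (P 1) ix * crd (P 1) iy),
      crd (E 1) j = T 1%N 1%N * (crd (P 1) ix * crd (E 0) iy),
      [/\ T 0%N 2%N = 0, T 0%N 3%N = 0 & T 0%N 4%N = 0] &
      [/\ T 1%N 2%N = k * T 1%N 1%N, T 1%N 3%N = k ^ 2 * T 1%N 1%N &
          T 2%N 2%N = 2 * k * T 2%N 1%N - k ^ 2 * T 2%N 0%N + lam * T 1%N 1%N]].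
Proof.
have [Ex Ey Ez Ew] := monge_form_dir_coords.
have [Px Pz Pw] := monge_form_tangent_coords.
have [Hx He _ _] := Hruled.
eexists; eexists => f j fj T.
have Hf : order_gt 1 f.
  by case: fj => -[-> _]; have [] := monge_jet1 Hmonge.
have Pj : crd (P 1) j = 0 by case: fj => -[_ ->].
have Ej : crd (E 0) j = 0 by case: fj => -[_ ->].
have T00 : T 0%N 0%N = 0 by exact: (order_gt_taylor_coef 1).
have T10 : T 1%N 0%N = 0 by exact: (order_gt_taylor_coef 1).
have T01 : T 0%N 1%N = 0 by exact: (order_gt_taylor_coef 1).
have Hd := smooth_germ_differentiable_near 5 _ (proj1 Hf).
have Hjet al be i := has_jet_ruled_coord _ _ _ _ _ t0 A i al be Hx He Hu.
have graph al be : locally 0 (fun s =>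
    let q := affine_coords A (ruled_map x e u0 t0) (ruled_map x e (u0 + al * s) (t0 + be * s)) in
    f (crd q ix) (crd q iy) = crd q j).
  apply: filter_imp (locally_2d_line _ _ _ al be (monge_graph Hmonge)) => s [].
  by case: fj => -[-> ->].
(* Both sides of the graph equation are expanded along each line of parameters, and their jets are
   equated. *)
have key al be := has_jet_unique _ _ _ (has_jet_ext_near _ _ _ (graph al be)
  (has_jet_comp _ _ _ _ _ Hd (Hjet al be ix) (Hjet al be iy) erefl erefl)) (Hjet al be j).
have := ruling_relations T
  (crd (P 1) ix) (crd (P 2) ix) (crd (P 3) ix) (crd (P 4) ix)
  (crd (E 1) ix) (crd (E 2) ix) (crd (E 3) ix)
  (crd (P 1) iy) (crd (P 2) iy) (crd (P 3) iy) (crd (P 4) iy)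
  (crd (E 0) iy) (crd (E 1) iy) (crd (E 2) iy) (crd (E 3) iy)
  0 (crd (P 2) j) (crd (P 3) j) (crd (P 4) j) (crd (E 1) j) (crd (E 2) j) (crd (E 3) j)
  T00 T10 T01 Px Ey.
case=> [al be|E1 E2 E3 E4].
  have := key al be.
  rewrite -/(ruled_taylor x e u0 t0 1) -/(ruled_taylor x e u0 t0 2) -/(ruled_taylor x e u0 t0 3).
  rewrite -/(ruled_taylor x e u0 t0 4) -/(P 1) -/(P 2) -/(P 3) -/(P 4).
  rewrite -/(E 0) -/(E 1) -/(E 2) -/(E 3) Ex Ej Pj !Rmult_0_r !Rplus_0_r.
  by [].
split; [split; [exact: (proj1 Hf)|by []] | exact: E1 | exact: E2 | exact: E3 | exact: E4].
Qed.

End Monge.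

(** * Independence of the quadratic parts in every Monge form *)

Lemma crd_change_coords (A A' : 'M[R]_4) (v : vec4) (j : 'I_4) :
  A' \in unitmx ->
  let M := (invmx A' *m A)%R in
  crd (v *m A)%R j
  = crd (v *m A')%R ix * M ix j + crd (v *m A')%R iy * M iy j
    + crd (v *m A')%R iz * M iz j + crd (v *m A')%R iw * M iw j.
Proof. by move=> A'u M; rewrite -crd_mulmx /M mulmxA mulmxK. Qed.

(* If (h1, h2) kills the quadratic parts of (f1, f2), then the covector
   h1 dz + h2 dw vanishes on the tangent plane and on F_uu, F_ut; in the coordinates of a
   Monge form with independent quadratic parts such a covector is 0. *)
Lemma parabolic_quadratic_det (a b : Rbar) (x e : R -> vec4) (u0 t0 : R)
    (A : 'M[R]_4) (f1 f2 : R -> R -> R) :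
  ruled_surface a b x e -> in_interval a b u0 -> parabolic_point x e u0 t0 ->
  monge_form x e u0 t0 A f1 f2 ->
  taylor_coef f1 2 0 * taylor_coef f2 1 1 - taylor_coef f1 1 1 * taylor_coef f2 2 0 <> 0.
Proof.
move=> Hr Hu [A' [g1 [g2 [Hg ind]]]] Hf D0.
have uA := monge_affine Hf; have uA' := monge_affine Hg.
have [Ex Ey Ez Ew] := monge_form_dir_coords _ _ _ _ _ _ _ _ _ Hr Hu Hf.
have [Px Pz Pw] := monge_form_tangent_coords _ _ _ _ _ _ _ _ _ Hr Hu Hf.
have [Ex' Ey' Ez' Ew'] := monge_form_dir_coords _ _ _ _ _ _ _ _ _ Hr Hu Hg.
have [Px' Pz' Pw'] := monge_form_tangent_coords _ _ _ _ _ _ _ _ _ Hr Hu Hg.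
have [? [? HT]] := monge_form_taylor _ _ _ _ _ _ _ _ _ Hr Hu Hf.
have [? [? HT']] := monge_form_taylor _ _ _ _ _ _ _ _ _ Hr Hu Hg.
have [_ P1 E1 _ _] := HT f1 iz (or_introl (conj erefl erefl)).
have [_ P2 E2 _ _] := HT f2 iw (or_intror (conj erefl erefl)).
have [_ P1' E1' [T02 _ _] _] := HT' g1 iz (or_introl (conj erefl erefl)).
have [_ P2' E2' [T02' _ _] _] := HT' g2 iw (or_intror (conj erefl erefl)).
have tr v j := crd_change_coords A A' v j uA'.
move: tr; set M := (invmx A' *m A)%R => tr.
(* Both charts send the tangent plane to the xy-plane, so the transition matrix has no z or w
   component on x and y. *)
have My j : j = iz \/ j = iw -> M iy j = 0.
  move=> Hj; have : crd (curve_taylor e u0 0 *m A)%R j = 0 by case: Hj => ->.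
  by rewrite tr Ex' Ez' Ew' => H; apply: (Rmult_eq_reg_l _ _ _ _ Ey'); lra.
have Mx j : j = iz \/ j = iw -> M ix j = 0.
  move=> Hj; have : crd (ruled_taylor x e u0 t0 1 *m A)%R j = 0 by case: Hj => ->.
  by rewrite tr Pz' Pw' My // => H; apply: (Rmult_eq_reg_l _ _ _ _ Px'); lra.
(* A nonzero vector in the left kernel of the singular 2 by 2 matrix of quadratic coefficients,
   taken from a nonzero column when there is one. *)
have [h1 [h2 [H20 H11 hn0]]] : exists h1 h2, [/\
    h1 * taylor_coef f1 2 0 + h2 * taylor_coef f2 2 0 = 0,
    h1 * taylor_coef f1 1 1 + h2 * taylor_coef f2 1 1 = 0 & ~ (h1 = 0 /\ h2 = 0)].
  have [z11|n11] := Req_dec (taylor_coef f1 1 1) 0; last first.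
    by exists (taylor_coef f2 1 1), (- taylor_coef f1 1 1); split; [lra|lra|case; lra].
  have [z12|n12] := Req_dec (taylor_coef f2 1 1) 0; last first.
    by exists (taylor_coef f2 1 1), (- taylor_coef f1 1 1); split; [lra|lra|case; lra].
  have [z21|n21] := Req_dec (taylor_coef f1 2 0) 0.
    by exists 1, 0; split; [lra|lra|case; lra].
  exists (taylor_coef f2 2 0), (- taylor_coef f1 2 0).
  by split; [lra|rewrite z11 z12; lra|case; lra].
apply: hn0.
have a0 : crd (ruled_taylor x e u0 t0 1 *m A')%R ix * crd (curve_taylor e u0 0 *m A')%R iy <> 0.
  exact: Rmult_integral_contrapositive_currified.
(* The covector is evaluated on F_ut, then for [Q20] on F_uu / 2, and the results are read in the
   chart of (g1, g2). *)
have Q11 : (h1 * M iz iz + h2 * M iz iw) * taylor_coef g1 1 1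
         + (h1 * M iw iz + h2 * M iw iw) * taylor_coef g2 1 1 = 0.
  apply: (Rmult_eq_reg_r _ _ _ _ a0).
  have : h1 * crd (curve_taylor e u0 1 *m A)%R iz + h2 * crd (curve_taylor e u0 1 *m A)%R iw = 0.
    rewrite E1 E2; set q := (_ * crd _ iy).
    transitivity ((h1 * taylor_coef f1 1 1 + h2 * taylor_coef f2 1 1) * q); first by ring.
    by rewrite H11; ring.
  rewrite !tr E1' E2' !My ?Mx; try by [left | right].
  lra.
have Q20 : (h1 * M iz iz + h2 * M iz iw) * taylor_coef g1 2 0
         + (h1 * M iw iz + h2 * M iw iw) * taylor_coef g2 2 0 = 0.
  apply: (Rmult_eq_reg_r _ _ _ _ (pow_nonzero _ 2 Px')).
  have : h1 * crd (ruled_taylor x e u0 t0 2 *m A)%R iz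
       + h2 * crd (ruled_taylor x e u0 t0 2 *m A)%R iw = 0.
    rewrite P1 P2; set p := crd _ ix; set q := crd _ iy.
    transitivity ((h1 * taylor_coef f1 2 0 + h2 * taylor_coef f2 2 0) * p ^ 2
      + (h1 * taylor_coef f1 1 1 + h2 * taylor_coef f2 1 1) * (p * q)); first by ring.
    by rewrite H20 H11; ring.
  rewrite !tr P1' P2' !My ?Mx; try by [left | right].
  set p := crd (ruled_taylor x e u0 t0 1 *m A')%R ix.
  set q := crd (ruled_taylor x e u0 t0 1 *m A')%R iy => H.
  have H' : ((h1 * M iz iz + h2 * M iz iw) * taylor_coef g1 1 1
         + (h1 * M iw iz + h2 * M iw iw) * taylor_coef g2 1 1) * (p * q) = 0.
    by rewrite Q11; ring.
  lra.
have [k1 k2] : h1 * M iz iz + h2 * M iz iw = 0 /\ h1 * M iw iz + h2 * M iw iw = 0.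
  apply: ind => X Y; rewrite /quadratic_part !partial_derive_taylor_coef T02 T02' /=.
  set c1 := (h1 * _ + _) in Q11 Q20 *; set c2 := (h1 * _ + _) in Q11 Q20 *.
  transitivity ((c1 * taylor_coef g1 2 0 + c2 * taylor_coef g2 2 0) * X ^ 2
    + (c1 * taylor_coef g1 1 1 + c2 * taylor_coef g2 1 1) * (X * Y)); first by field.
  by rewrite Q11 Q20; ring.
pose h : vec4 := (\row_i (if i == iz then h1 else if i == iw then h2 else 0))%R.
have hx : crd h ix = 0 by rewrite /h /crd mxE.
have hy : crd h iy = 0 by rewrite /h /crd mxE.
have hz : crd h iz = h1 by rewrite /h /crd mxE.
have hw : crd h iw = h2 by rewrite /h /crd mxE.
have hM : (h *m M^T)%R = 0%R.
  apply: vec4_eqP; rewrite crd0 crd_mulmx ![(M^T)%R _ _]mxE hx hy hz hw.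
  - by rewrite (Mx iz) ?(Mx iw); [ring | right | left].
  - by rewrite (My iz) ?(My iw); [ring | right | left].
  - lra.
  - lra.
have Mu : (M^T)%R \in unitmx by rewrite unitmx_tr unitmx_mul unitmx_inv uA' uA.
have h0 : h = 0%R by rewrite -(mulmxK Mu h) hM mul0mx.
by rewrite -hz -hw h0 !crd0.
Qed.

(** * Assembling the projective transformation *)

Lemma cramer2 (l1 m1 l2 m2 c1 c2 : R) :
  l1 * m2 - m1 * l2 <> 0 ->
  exists r s, c1 = l1 * r + m1 * s /\ c2 = l2 * r + m2 * s.
Proof.
move=> D0; exists ((c1 * m2 - m1 * c2) / (l1 * m2 - m1 * l2)).
by exists ((l1 * c2 - c1 * l2) / (l1 * m2 - m1 * l2)); split; field.
Qed.

(** The lower right block carries (x^2, xy) to the quadratic parts of the given Monge form; the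
    three upper entries are the parameters that act on the cubic terms. *)
Definition normalizing_mx (q14 q23 q24 l1 m1 l2 m2 : R) : 'M[R]_4 :=
  (\matrix_(i, j) nth 0 (nth [::] [:: [:: R1; R0; R0; q14]; [:: R0; R1; q23; q24];
                                      [:: R0; R0; l1; m1]; [:: R0; R0; l2; m2]] i) j)%R.

Lemma normalizing_mx_unit (q14 q23 q24 l1 m1 l2 m2 : R) :
  l1 * m2 - m1 * l2 <> 0 -> normalizing_mx q14 q23 q24 l1 m1 l2 m2 \in unitmx.
Proof.
move=> D0; apply: unitmx4P => v vQ.
have H j : crd (v *m normalizing_mx q14 q23 q24 l1 m1 l2 m2)%R j = 0 by rewrite vQ crd0.
move: {H}(H ix) (H iy) (H iz) (H iw); rewrite !crd_mulmx !mxE /= => Hx Hy Hz Hw.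
have vx : crd v ix = 0 by lra.
have vy : crd v iy = 0 by lra.
rewrite vx vy in Hz Hw.
apply: vec4_eqP; rewrite crd0 //; apply: (Rmult_eq_reg_r _ _ _ _ D0).
- transitivity (m2 * (crd v iz * l1 + crd v iw * l2) - l2 * (crd v iz * m1 + crd v iw * m2)).
    by ring.
  have -> : crd v iz * l1 + crd v iw * l2 = 0 by lra.
  have -> : crd v iz * m1 + crd v iw * m2 = 0 by lra.
  by ring.
- transitivity (l1 * (crd v iz * m1 + crd v iw * m2) - m1 * (crd v iz * l1 + crd v iw * l2)).
    by ring.
  have -> : crd v iz * l1 + crd v iw * l2 = 0 by lra.
  have -> : crd v iz * m1 + crd v iw * m2 = 0 by lra.
  by ring.
Qed.

Lemma order_gt_ext (k : nat) (f g : R -> R -> R) :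
  (forall X Y, f X Y = g X Y) -> order_gt k f -> order_gt k g.
Proof.
move=> H; suff -> : f = g by [].
apply: FunctionalExtensionality.functional_extensionality => X.
exact: FunctionalExtensionality.functional_extensionality.
Qed.

Theorem proposition4p1 (a b : Rbar) (x e : R -> vec4) (u0 t0 : R)
  (A : 'M[R]_4) (f1 f2 : R -> R -> R) :
  ruled_surface a b x e ->
  in_interval a b u0 ->
  parabolic_point x e u0 t0 ->
  monge_form x e u0 t0 A f1 f2 ->
  exists Gamma40 Gamma31 Theta40 : R,
    proj_equiv_jets 4 f1 f2
      (fun X Y : R => X ^ 2 + Gamma40 * X ^ 4 + Gamma31 * X ^ 3 * Y)
      (fun X Y : R => X * Y + Theta40 * X ^ 4).
Proof.
move=> Hr Hu Hp Hm.
have D0 := parabolic_quadratic_det _ _ _ _ _ _ _ _ _ Hr Hu Hp Hm.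
have [k [lam HT]] := monge_form_taylor _ _ _ _ _ _ _ _ _ Hr Hu Hm.
have [[S1 T1_0] _ _ [T1_02 T1_03 T1_04] [T1_12 T1_13 T1_22]] :=
  HT f1 iz (or_introl (conj erefl erefl)).
have [[S2 T2_0] _ _ [T2_02 T2_03 T2_04] [T2_12 T2_13 T2_22]] :=
  HT f2 iw (or_intror (conj erefl erefl)).
set l1 := taylor_coef f1 2 0 in D0 T1_22; set m1 := taylor_coef f1 1 1 in D0 T1_12 T1_13 T1_22.
set l2 := taylor_coef f2 2 0 in D0 T2_22; set m2 := taylor_coef f2 1 1 in D0 T2_12 T2_13 T2_22.
(* The coefficient vectors of x^3, x^2 y, x^4 and x^3 y are written in the basis (l1, l2), (m1, m2).
   The resulting parameters are common to both components, so [projective_normal_form] yields the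
   same denominator, target form and first two numerators for each. *)
have [r [s [r1 r2]]] := cramer2 _ _ _ _ (taylor_coef f1 3 0) (taylor_coef f2 3 0) D0.
have [r' [s' [r1' r2']]] := cramer2 _ _ _ _ (taylor_coef f1 2 1) (taylor_coef f2 2 1) D0.
have [B4 [B4' [b1 b2]]] := cramer2 _ _ _ _ (taylor_coef f1 4 0) (taylor_coef f2 4 0) D0.
have [C4 [C4' [c1 c2]]] := cramer2 _ _ _ _ (taylor_coef f1 3 1) (taylor_coef f2 3 1) D0.
rewrite r1' in T1_22; rewrite r2' in T2_22.
have N1 := projective_normal_form f1 l1 m1 k lam r s r' s' B4 B4' C4 C4' S1 T1_0
  (And3 erefl erefl T1_02) (And4 r1 r1' T1_12 T1_03) (And5 b1 c1 T1_22 T1_13 T1_04).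
have N2 := projective_normal_form f2 l2 m2 k lam r s r' s' B4 B4' C4 C4' S2 T2_0
  (And3 erefl erefl T2_02) (And4 r2 r2' T2_12 T2_03) (And5 b2 c2 T2_22 T2_13 T2_04).
move: N1 N2 => /=.
set p4 := lam + _ - _ - _; set p3 := C4' - _ - _ - _.
set G40 := B4 - _ - _ - _; set G31 := C4 - _ + _ - _ - _; set T40 := B4' - _ - _ => N1 N2.
exists G40, G31, T40.
exists (normalizing_mx (k - r') (- s) (r - s') l1 m1 l2 m2).
pose p2 := 2 * k - r'.
exists (\row_j nth R0 [:: r; p2; p3; p4] j)%R.
split.
- exact: normalizing_mx_unit.
- by move=> i j; rewrite !inE => /orP[] /eqP -> /orP[] /eqP ->; rewrite mxE.
- rewrite /lin4 /crd; split.
  + apply: order_gt_ext N1 => X Y; rewrite !mxE /= /p2.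
    by congr (_ / _ - f1 (_ / _) (_ / _)); ring.
  + apply: order_gt_ext N2 => X Y; rewrite !mxE /= /p2.
    by congr (_ / _ - f2 (_ / _) (_ / _)); ring.
Qed.
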